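(* Let $q\geq 5$ be an odd prime or a power of two. Let $K_q=\mathbb{Q}(\zeta_q+\zeta_q^{-1})$ be the maximal totally real subfield of the $q$-th cyclotomic field, with ring of integers $\mathcal{O}_q$. If every element of $2\mathcal{O}_q^+$ is a sum of squares of elements of $\mathcal{O}_q$, then $q=5$, $q=7$, or $q=8$.
   Context: $\zeta_q=e^{2\pi i/q}$. $\mathcal{O}_q^+$ is the set of totally positive elements of $\mathcal{O}_q$ (positive under every embedding $K_q\hookrightarrow\mathbb{R}$), and $2\mathcal{O}_q^+=\{2\alpha:\alpha\in\mathcal{O}_q^+\}$. A sum of squares means a sum of finitely many (arbitrarily many) squares. *)

(* Defs.v *)
From HB Require Import structures.
From mathcomp Require Import all_boot all_order all_algebra.
From mathcomp Require Import boolp classical_sets reals trigo.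
From mathcomp Require Import complex.

Set Implicit Arguments.
Unset Strict Implicit.
Unset Printing Implicit Defensive.

Import Order.TTheory GRing.Theory Num.Theory.

Local Open Scope ring_scope.
Local Open Scope complex_scope.
Local Open Scope classical_set_scope.

(* [generated x] is the field generated by [x]: the intersection of all
   subfields of [F] containing [x].  In characteristic 0 the prime field is Q,
   so this is Q(x). *)
Section Generated.
Variables (F : fieldType) (x : F).

Definition in_generated : {pred F} :=
  fun y => `[< forall S : divringClosed F, x \in S -> y \in S >].

Lemma in_generated_divring_closed : divring_closed in_generated.
Proof.
split=> [|y z /asboolP yx /asboolP zx|y z /asboolP yx /asboolP zx];
  apply/asboolP => S xS; first exact: rpred1.
- exact: rpredB (yx S xS) (zx S xS).
- exact: rpred_div (yx S xS) (zx S xS).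
Qed.

HB.instance Definition _ :=
  GRing.isDivringClosed.Build F in_generated in_generated_divring_closed.

Record generated := Generated {
  generated_val : F;
  _ : generated_val \in in_generated }.

HB.instance Definition _ := [isSub for generated_val].
HB.instance Definition _ := [Choice of generated by <:].
HB.instance Definition _ :=
  [SubChoice_isSubIntegralDomain of generated by <:].
HB.instance Definition _ := [SubIntegralDomain_isSubField of generated by <:].

End Generated.

Section RealCyclotomic.
Variables (R : realType) (q : nat).

(* e^(2 i pi / q), written with Euler's formula. *)
Definition zeta : R[i] := cos (2 * pi / q%:R) +i* sin (2 * pi / q%:R).

Definition Kq : fieldType := generated (zeta + zeta^-1).

Definition Oq : set Kq := [set a | integralOver (intr : int -> Kq) a].

Definition Oq_pos : set Kq :=
  [set a | Oq a /\ forall s : {rmorphism Kq -> R}, 0 < s a].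

Definition twice_Oq_pos : set Kq := [set 2 * a | a in Oq_pos].

Definition sum_of_squares_Oq : set Kq :=
  [set a | exists (n : nat) (b : 'I_n -> Kq),
     (forall i, Oq (b i)) /\ a = \sum_(i < n) b i ^+ 2].

End RealCyclotomic.

(* Main.v *)
Require Import Defs.
From HB Require Import structures.
From mathcomp Require Import all_boot all_order all_algebra all_field.
From mathcomp Require Import boolp reals trigo complex.
From mathcomp Require Import zify ring lra.

(** Write theta_j = zeta^j + zeta^-j.  We exhibit a totally positive alpha such
    that 2 alpha is not a sum of squares.

    q = p >= 11 prime: alpha = 3 + theta_2 + theta_4 + theta_6, which equals
    1 + u (u - 2) (u - 3) with u = theta_1^2, so that it is positive at every
    real place.  An integer x is sum_k c(k) zeta^k for an even function
    c : F_p -> Z, unique up to a constant.  For h <> 0 the trace form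
    x |-> Tr (x^2 (2 - theta_2h)) / p is half of the energy
    sum_m (c(m + h) - c(m - h))^2, so that a sum of squares with value beta has
    total energy 2 (b(0) - b(2h)), where b is the coefficient function of beta.
    - Since squaring is injective modulo 2, a sum of squares with value alpha has
      sum_i c_i = (indicator of {-3..3}) mod 2, which forces energy at least 8 for
      h = 2, whereas the total energy is 4.
    - If 2 alpha = sum x_i^2, the total energies for h = 1, 2, 3 are 8 each.  Every
      x <> 0 has energy at least 2, and energy 2 for two values of h forces
      x = +-1.  So the sum of the three energies is 6 for x = +-1 and at least 10
      for the other x <> 0, which leaves few cases; since sum x_i is divisible by 2,
      in each of them alpha is itself a sum of squares, a contradiction.

    q = 2n >= 16 a power of two: alpha = 2 + theta_1.  If 2 alpha = sum x_i^2 and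
    x_i = sum_(k < n) c_i(k) zeta^k, then sum_i sum_(k < n) c_i(k)^2 = 4, and a
    parity argument shows that the part of this sum over odd k is divisible by 4.
    Hence all the supports lie in a single class modulo 2, and the coefficient of
    zeta in sum x_i^2 vanishes, although it is 2 in 2 alpha. *)

Set Implicit Arguments.
Unset Strict Implicit.
Unset Printing Implicit Defensive.

Import Order.TTheory GRing.Theory Num.Theory.

(** * Sums of squares in Z[zeta_q] for a prime q *)

(** The points moved by [s] fall into pairs [{x, s x}] with equal values; the enumeration rank
    selects one point of each pair. *)
Lemma sum_involution (T : finType) (s : T -> T) (f : T -> int) :
  involutive s -> (forall x, f (s x) = f x) ->
  exists y : int, (\sum_(x | s x != x) f x = 2 * y)%R.
Proof.
move=> sK fs; pose r := @enum_rank T.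
exists (\sum_(x | (r x < r (s x))%N) f x)%R.
rewrite (bigID (fun x => (r x < r (s x))%N)) /= -[(2%R)]/(1 + 1)%R mulrDl mul1r.
congr (_ + _)%R.
  apply: eq_bigl => x; case: ltngtP => rx; rewrite ?andbF // andbT.
  by apply/eqP => sx; rewrite sx ltnn in rx.
rewrite [RHS](reindex_inj (inv_inj sK)) /=; apply: eq_big => [x|x _]; last by rewrite fs.
rewrite sK -leqNgt andbC leq_eqVlt; case: eqVneq => [/val_inj/enum_rank_inj->|] /=.
  by rewrite eqxx /= ltnn.
move=> rx; case: ltnP => //= rlt; apply/eqP => sx.
by rewrite sx ltnn in rlt.
Qed.

Lemma sqr_parity (x : int) : exists y : int, (x ^+ 2 = x + 2 * y)%R.
Proof.
have r2 : ((x %% 2)%Z ^+ 2 = (x %% 2)%Z)%R.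
  have : ((x %% 2)%Z = 0 \/ (x %% 2)%Z = 1)%R by lia.
  by case=> ->.
exists (2 * (x %/ 2)%Z ^+ 2 + 2 * (x %/ 2)%Z * (x %% 2)%Z - (x %/ 2)%Z)%R.
move: (divz_eq x 2) r2; move: (x %/ 2)%Z (x %% 2)%Z => a r -> r2.
by rewrite sqrrD r2; ring.
Qed.

Lemma sum_sqr_odd (I : Type) (s : seq I) (f : I -> int) x :
  (\sum_(i <- s) f i = 1 + 2 * x -> 1 <= \sum_(i <- s) f i ^+ 2)%R.
Proof.
have [y yE] : exists y : int, (\sum_(i <- s) f i ^+ 2 = \sum_(i <- s) f i + 2 * y)%R.
  elim: s => [|i s [y IHs]]; first by exists 0%R; rewrite !big_nil.
  by have [y' y'E] := sqr_parity (f i); exists (y + y')%R; rewrite !big_cons IHs y'E; ring.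
have : (0 <= \sum_(i <- s) f i ^+ 2)%R by apply: sumr_ge0 => i _; apply: sqr_ge0.
by rewrite yE => S0 SE; move: S0; rewrite SE; lia.
Qed.

(** * Small residues modulo q >= 11 and the coefficients of alpha *)

Section SmallResidues.
Local Open Scope ring_scope.
Variable q : nat.
Hypotheses (q_pr : prime q) (q_ge11 : (11 <= q)%N).

(** Since 11 <= q, comparisons of small residues in F_q reduce to comparisons of integers. *)
Lemma intrF_eq0 (i : int) : (`|i| < 11)%N -> (i%:~R == 0 :> 'F_q) = (i == 0).
Proof.
move=> i11; have nF n : (n < 11)%N -> (n%:R == 0 :> 'F_q) = (n == 0)%N.
  move=> n11; rewrite -(dvdn_pcharf (pchar_Fp q_pr)).
  by case: n n11 => [|n] n11; rewrite ?dvdn0 // gtnNdvd //; lia.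
by case: i i11 => n i11; rewrite ?NegzE ?rmorphN ?oppr_eq0 -?pmulrn nF.
Qed.

Lemma addF_eq0 (x : 'F_q) : (x + x == 0) = (x == 0).
Proof.
have two0 : (2%:R == 0 :> 'F_q) = false := @intrF_eq0 2 isT.
by rewrite -mulr2n -mulr_natl mulf_eq0 two0.
Qed.

Lemma oppF_eq (x : 'F_q) : (- x == x) = (x == 0).
Proof. by rewrite eq_sym -addr_eq0 addF_eq0. Qed.

(* [alphaT] lists the coefficients of 3 + theta_2 + theta_4 + theta_6 at the even
   exponents 2j; doubling is a bijection of F_q. *)
Definition alphaT (j : 'F_q) : int :=
  3 * (j == 0)%:R + \sum_(i <- [:: 1; 2; 3; -1; -2; -3] : seq int) (j == i%:~R)%:R.

Definition alpha : {ffun 'F_q -> int} := [ffun k => alphaT (k / 2%:R)].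

Lemma alpha_double j : alpha (j + j) = alphaT j.
Proof.
have two0 : (2%:R == 0 :> 'F_q) = false := @intrF_eq0 2 isT.
by rewrite ffunE -mulr2n -(mulr_natr j) mulfK ?two0.
Qed.

Lemma alphaT_int (j : int) : (`|j| < 8)%N ->
  alphaT j%:~R = if j == 0 then 3 else if (`|j| < 4)%N then 1 else 0.
Proof.
move=> j8; rewrite /alphaT !big_cons big_nil.
(* Here |j - i| <= 7 + 3 = 10, which is within reach of [intrF_eq0]. *)
have jE (i : int) : (`|i| < 4)%N -> (j%:~R == i%:~R :> 'F_q) = (j == i).
  by move=> i4; rewrite -subr_eq0 -intrB intrF_eq0 ?subr_eq0 //; lia.
rewrite -[X in j%:~R == X]/(0%:~R) !jE //.
by case: j {jE} j8 => n; do 8 (case: n => [|n] //).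
Qed.

Lemma alpha0 : alpha 0 = 3.
Proof. by rewrite -[0]addr0 alpha_double (@alphaT_int 0). Qed.

End SmallResidues.

(** * Characters, energies and the argument for primes q >= 11 *)

Section PrimeCase.
Local Open Scope ring_scope.
Variables (q : nat) (z : algC).
Hypotheses (q_pr : prime q) (z_prim : q.-primitive_root z).

Definition chi (k : 'F_q) : algC := z ^+ k.

Lemma chi0 : chi 0 = 1.
Proof. by rewrite /chi expr0. Qed.

Lemma chiD k l : chi (k + l) = chi k * chi l.
Proof.
rewrite /chi -exprD -(prim_expr_mod z_prim (k + l)); congr (_ ^+ _).
by rewrite /=; congr (_ %% _)%N; exact: Fp_cast.
Qed.

Lemma chi_eq1 k : (chi k == 1) = (k == 0).
Proof.
rewrite /chi -(prim_order_dvd z_prim); apply/idP/eqP => [dv|->]; last exact: dvdn0.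
apply/val_inj => /=; apply/eqP; case: posnP => // k0.
by have := dvdn_leq k0 dv; have := ltn_ord k; rewrite [X in (_ < X)%N]Fp_cast //; lia.
Qed.

(** Multiplication by [chi t] permutes the terms, so the sum vanishes unless [chi t] is 1. *)
Lemma chi_sum t : \sum_k chi (k * t) = if t == 0 then q%:R else 0.
Proof.
have [->|t0] := eqVneq.
  rewrite (eq_bigr (fun=> 1)) => [|k _]; last by rewrite mulr0 chi0.
  by rewrite sumr_const card_Fp.
apply/eqP; have := chi_eq1 t; rewrite (negbTE t0) => /negbT t1.
suff : (chi t - 1) * (\sum_k chi (k * t)) == 0.
  by rewrite mulf_eq0 subr_eq0 (negbTE t1).
rewrite mulrBl mul1r subr_eq0 mulr_sumr; apply/eqP.
rewrite [RHS](reindex_inj (addrI 1)) /=; apply: eq_bigr => k _.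
by rewrite mulrDl mul1r chiD.
Qed.

(** For t <> 0 this is a conjugate of sum_k c(k) zeta^k; t = 0 is not a conjugate but gives the sum
    of the coefficients. *)
Definition ev (c : {ffun 'F_q -> int}) t : algC := \sum_k (c k)%:~R * chi (k * t).

Lemma evD c c' t : ev (c + c') t = ev c t + ev c' t.
Proof.
by rewrite -big_split; apply: eq_bigr => k _; rewrite ffunE rmorphD mulrDl.
Qed.

Lemma evN c t : ev (- c) t = - ev c t.
Proof.
by rewrite /ev -sumrN; apply: eq_bigr => k _; rewrite ffunE rmorphN mulNr.
Qed.

Lemma ev_sum (s : seq {ffun 'F_q -> int}) t :
  ev (\sum_(c <- s) c) t = \sum_(c <- s) ev c t.
Proof.
elim: s => [|c s IHs]; last by rewrite !big_cons evD IHs.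
by rewrite !big_nil /ev big1 // => k _; rewrite ffunE mul0r.
Qed.

Lemma ev_const a t : t != 0 -> ev [ffun => a] t = 0.
Proof.
move=> t0; have := chi_sum t; rewrite (negbTE t0) => <-.
have -> : ev [ffun => a] t = a%:~R * \sum_k chi (k * t).
  by rewrite mulr_sumr; apply: eq_bigr => k _; rewrite ffunE.
by rewrite chi_sum (negbTE t0) mulr0.
Qed.

Definition delta : {ffun 'F_q -> int} := [ffun k => (k == 0)%:R].

Lemma ev_delta t : ev delta t = 1.
Proof.
rewrite /ev (bigD1 0) //= ffunE eqxx mul0r chi0 mulr1 big1 ?addr0 // => k k0.
by rewrite ffunE (negbTE k0) mul0r.
Qed.

(** Fourier inversion: the transform of h = f - g is supported at t = 0, so h is constant. *)
Lemma ev_inj_const f g : (forall t, t != 0 -> ev f t = ev g t) ->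
  forall k l, f k - f l = g k - g l.
Proof.
move=> fg k l; set h := f - g.
have h0 t : t != 0 -> ev h t = 0.
  by move=> t0; rewrite evD evN fg ?subrr.
suff hE m : q%:R * (h m)%:~R = ev h 0.
  have : h k = h l; last by rewrite !ffunE => hkl; rewrite -[f k](subrK (g k)) hkl; ring.
  apply/(@intr_inj algC)/(@mulfI _ q%:R); last by rewrite !hE.
  by rewrite pnatr_eq0 -lt0n prime_gt0.
have <- : \sum_t chi (- m * t) * ev h t = ev h 0.
  rewrite (bigD1 0) //= mulr0 chi0 mul1r big1 ?addr0 // => t t0.
  by rewrite h0 // mulr0.
under eq_bigr do rewrite mulr_sumr.
rewrite exchange_big /= (bigD1 m) //= [X in _ + X]big1 ?addr0 => [|k' k'm].
  under eq_bigr do rewrite mulrCA -chiD mulNr addNr chi0 mulr1.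
  by rewrite sumr_const card_Fp // mulr_natl.
under eq_bigr do rewrite mulrCA -chiD -mulrDl [(_ + _) * _]mulrC.
by rewrite -mulr_sumr chi_sum addrC subr_eq0 (negbTE k'm) mulr0.
Qed.

Definition conv (c : {ffun 'F_q -> int}) : {ffun 'F_q -> int} :=
  [ffun m => \sum_k c k * c (m - k)].

Lemma ev_conv c t : ev (conv c) t = ev c t ^+ 2.
Proof.
rewrite expr2 {2}/ev mulr_suml.
under eq_bigr => k _.
  rewrite mulr_sumr (reindex_inj (addIr (- k))) /=.
  under eq_bigr => m _ do
    rewrite mulrACA -chiD -mulrDl [k + _]addrC subrK -rmorphM.
  over.
rewrite exchange_big; apply: eq_bigr => m _.
by rewrite -mulr_suml ffunE rmorph_sum.
Qed.

Definition evenf (c : {ffun 'F_q -> int}) := [forall k, c (- k) == c k].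

Lemma evenfP (c : {ffun 'F_q -> int}) : reflect (forall k, c (- k) = c k) (evenf c).
Proof. exact: 'forall_eqP. Qed.

(* The identity of [ev] at all t <> 0 is an identity in the field and all its
   conjugates; coefficient functions only matter up to a constant. *)
Definition sumsq_repr (s : seq {ffun 'F_q -> int}) b :=
  all evenf s /\ forall t, t != 0 -> \sum_(c <- s) ev c t ^+ 2 = ev b t.

Lemma sumsq_conv s b : sumsq_repr s b ->
  forall k l, \sum_(c <- s) conv c k - \sum_(c <- s) conv c l = b k - b l.
Proof.
move=> [_ sb] k l.
have := @ev_inj_const (\sum_(c <- s) conv c) b _ k l.
rewrite !sum_ffunE; apply => t t0; rewrite -sb //.
rewrite -(@big_map _ _ _ _ _ conv s xpredT id) ev_sum big_map.
by apply: eq_bigr => c _; rewrite ev_conv.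
Qed.

Definition energy (h : 'F_q) (c : {ffun 'F_q -> int}) : int :=
  \sum_m (c (m + h) - c (m - h)) ^+ 2.

(** When the square is expanded, both square terms become [conv c 0] after a shift by h, and
    evenness turns the cross term into [conv c (h + h)]. *)
Lemma energy_conv h (c : {ffun 'F_q -> int}) : evenf c ->
  energy h c = 2 * (conv c 0 - conv c (h + h)).
Proof.
move=> /evenfP ec; rewrite !ffunE /energy.
have sq : \sum_m c m * c (0 - m) = \sum_m c (m + h) ^+ 2.
  rewrite (reindex_inj (addIr h)); apply: eq_bigr => m _.
  by rewrite sub0r ec.
have sq' : \sum_m c m * c (0 - m) = \sum_m c (m - h) ^+ 2.
  rewrite (reindex_inj (addIr (- h))); apply: eq_bigr => m _.
  by rewrite sub0r ec.
have cr : \sum_m c m * c (h + h - m) = \sum_m c (m + h) * c (m - h).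
  rewrite (reindex_inj (addIr h)); apply: eq_bigr => m _ /=.
  by rewrite -[m - h]opprK ec; congr (_ * c _); ring.
rewrite cr; have -> : forall x y : int, 2 * (x - y) = x + x - (y + y) by move=> *; ring.
rewrite {1}sq sq' -!big_split -sumrB /=; apply: eq_bigr => m _; ring.
Qed.

Lemma sumsq_energy s b h : sumsq_repr s b ->
  \sum_(c <- s) energy h c = 2 * (b 0 - b (h + h)).
Proof.
move=> sb; rewrite -(sumsq_conv sb) -sumrB mulr_sumr.
case: sb => /allP se _; rewrite !big_seq; apply: eq_bigr => c /se ec.
exact: energy_conv.
Qed.

Hypothesis q_ge11 : (11 <= q)%N.

(** Modulo 2, the terms of [conv c (j + j)] cancel in pairs under k -> 2j - k, except for the fixed
    point k = j, which contributes c(j)^2 = c(j). *)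
Lemma sumsq_parity s b : sumsq_repr s b -> forall j,
  exists y : int, \sum_(c <- s) c j - \sum_(c <- s) c 0 = b (j + j) - b 0 + 2 * y.
Proof.
move=> sb j.
have cp (c : {ffun 'F_q -> int}) k : exists y : int, conv c (k + k) = c k + 2 * y.
  pose f m := c m * c (k + k - m).
  have [||y yE] := @sum_involution _ (fun m : 'F_q => k + k - m) f.
  - by move=> m; rewrite subKr.
  - by move=> m; rewrite /f subKr mulrC.
  have [y' y'E] := sqr_parity (c k).
  rewrite ffunE -/f (bigD1 k) //= addrK -expr2 y'E; exists (y' + y).
  rewrite mulrDr -yE -addrA; congr (_ + (_ + _)); apply: eq_bigl => m.
  rewrite subr_eq -subr_eq0; have -> : k + k - (m + m) = k - m + (k - m) by ring.
  by rewrite (addF_eq0 q_pr q_ge11) subr_eq0 eq_sym.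
have [y yE] : exists y : int, \sum_(c <- s) conv c (j + j) - \sum_(c <- s) conv c 0 =
    \sum_(c <- s) c j - \sum_(c <- s) c 0 + 2 * y.
  elim: (s) => [|c s' [y IH]]; first by exists 0; rewrite !big_nil.
  have [y1] := cp c j; have [y2] := cp c 0; rewrite addr0 !big_cons => -> ->.
  exists (y + y1 - y2); move: IH; move: (c j) (c 0).
  move: (\sum_(c <- s') conv c (j + j)) (\sum_(c <- s') conv c 0).
  by move: (\sum_(c <- s') c j) (\sum_(c <- s') c 0); lia.
by exists (- y); rewrite -(sumsq_conv sb) yE; ring.
Qed.


Lemma energy_ge0 h (c : {ffun 'F_q -> int}) : 0 <= energy h c.
Proof. by apply: sumr_ge0 => m _; apply: sqr_ge0. Qed.

Lemma energy_parity h (c : {ffun 'F_q -> int}) : evenf c ->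
  exists y : int, energy h c = 2 * y.
Proof. by move=> ec; rewrite energy_conv //; eexists. Qed.

(** Steps of length 2h lead from 2h through all nonzero residues; the two excluded values of m are
    the steps leaving and reaching 0. *)
Lemma shift_const h (c : {ffun 'F_q -> int}) : h != 0 ->
  (forall m, m != h -> m != - h -> c (m + h) = c (m - h)) ->
  forall k, k != 0 -> c k = c (h + h).
Proof.
move=> h0 ch k k0.
suff ci n : (n.+1 < q)%N -> c ((h + h) *+ n.+1) = c (h + h).
  pose n : 'F_q := k / (h + h).
  have nE : k = (h + h) *+ n.
    by rewrite -mulr_natr natr_Zp mulrC divfK // (addF_eq0 q_pr q_ge11).
  case En : (nat_of_ord n) => [|n']; first by rewrite nE En mulr0n eqxx in k0.
  rewrite nE En ci // -En; have := ltn_ord n; rewrite [X in (_ < X)%N]Fp_cast //.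
elim: n => [//|n IHn] n2; rewrite -[RHS]IHn ?(ltnW n2) //.
have mE l : h + h != 0 -> (h + h) *+ l == 0 -> (q %| l)%N.
  by rewrite -mulr_natr mulf_eq0 => /negbTE -> /=; rewrite (dvdn_pcharf (pchar_Fp q_pr)).
have -> : (h + h) *+ n.+2 = (h + h) *+ n.+1 + h + h by rewrite [in LHS]mulrSr addrA.
rewrite ch ?addrK //.
  apply/eqP => /(canRL (addrK h)) /eqP; rewrite subrr => /mE.
  by rewrite (addF_eq0 q_pr q_ge11) => /(_ h0) /dvdn_leq; lia.
apply/eqP => /(congr1 (+%R^~ h)) /eqP; rewrite addNr -addrA -mulrSr => /mE.
by rewrite (addF_eq0 q_pr q_ge11) => /(_ h0) /dvdn_leq; lia.
Qed.

Lemma energy_eq0 h (c : {ffun 'F_q -> int}) : h != 0 -> energy h c = 0 ->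
  forall k, c k = c 0.
Proof.
move=> h0 /eqP; rewrite psumr_eq0 => [/allP ch k|m _]; last exact: sqr_ge0.
have {}ch m : c (m + h) = c (m - h).
  by have := ch m (mem_index_enum _); rewrite /= sqrf_eq0 subr_eq0 => /eqP.
have c0 : c (h + h) = c 0 by rewrite ch subrr.
by have [->//|k0] := eqVneq k 0; rewrite (shift_const h0).
Qed.

(** The difference g is odd, so its nonzero values come in opposite pairs; energy 2 leaves room for
    one pair only, with values 1 and -1. *)
Lemma energy_eq2 h (c : {ffun 'F_q -> int}) : evenf c -> energy h c = 2 ->
  exists2 mu, mu != 0 &
  forall m, c (m + h) - c (m - h) = (m == mu)%:R - (m == - mu)%:R.
Proof.
move=> /evenfP ec e2; pose g m := c (m + h) - c (m - h).
have gN m : g (- m) = - g m.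
  by rewrite /g opprB -(ec (m - h)) -(ec (m + h)) opprB opprD [h - m]addrC.
have [mu gmu] : exists mu, g mu != 0.
  apply/existsP; apply: contraPT e2; rewrite negb_exists => /forallP g0.
  by rewrite /energy big1 // => m _; move: (g0 m); rewrite negbK /g => /eqP ->.
have mu0 : mu != 0.
  by apply: contraNneq gmu => mu0; have := gN mu; rewrite mu0 oppr0; move: (g 0); lia.
have muN : - mu != mu by rewrite (oppF_eq q_pr q_ge11).
have := e2; rewrite /energy (bigD1 mu) //= (bigD1 (- mu)) //=.
rewrite -/(g mu) -/(g (- mu)) gN sqrrN; set S := \sum_(_ | _) _ => gS.
have S0 : 0 <= S by apply: sumr_ge0 => m _; apply: sqr_ge0.
have g1 : g mu ^+ 2 = 1 by nia.
have /eqP : S = 0 by lia.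
rewrite psumr_eq0 => [/allP g0|m _]; last exact: sqr_ge0.
have {}g0 m : m != mu -> m != - mu -> g m = 0.
  move=> m1 m2; have := g0 m (mem_index_enum _); rewrite m1 m2 /= => /eqP/eqP.
  by rewrite sqrf_eq0 => /eqP.
have [{}g1|{}g1] : g mu = 1 \/ g mu = -1 by nia.
  exists mu => // m; rewrite -/(g m); have [->|m1] := eqVneq m mu.
    by rewrite eq_sym (negbTE muN) subr0.
  have [->|m2] := eqVneq m (- mu); first by rewrite gN g1.
  by rewrite g0.
(* If g(mu) = -1, the value +1 is taken at the opposite point. *)
exists (- mu); rewrite ?oppr_eq0 // => m; rewrite -/(g m) opprK.
have [->|m1] := eqVneq m mu; first by rewrite eq_sym (negbTE muN) sub0r.
have [->|m2] := eqVneq m (- mu); first by rewrite gN g1.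
by rewrite g0.
Qed.

Lemma energy2_unit (h h' : 'F_q) (c : {ffun 'F_q -> int}) : evenf c ->
  h != 0 -> h' != 0 -> h' != h -> h' != - h ->
  energy h c = 2 -> energy h' c = 2 ->
  forall t, t != 0 -> ev c t ^+ 2 = 1.
Proof.
move=> ec h0 h'0 hh hNh /(energy_eq2 ec)[mu mu0 gmu] /(energy_eq2 ec)[nu nu0 gnu].
(* The h- and h'-differences of [c] commute, and both are +1 and -1 at a pair of
   opposite points: comparing supports forces mu = +-h. *)
have comm m : (m + h' == mu)%:R - (m + h' == - mu)%:R
    - ((m - h' == mu)%:R - (m - h' == - mu)%:R) =
    (m + h == nu)%:R - (m + h == - nu)%:R
    - ((m - h == nu)%:R - (m - h == - nu)%:R) :> int.
  rewrite -!gmu -!gnu [m + h' + h]addrAC [m - h' + h]addrAC [m + h' - h]addrAC.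
  by rewrite [m - h' - h]addrAC; ring.
have muN : (mu == - mu) = false by rewrite eq_sym (oppF_eq q_pr q_ge11); apply/negbTE.
have dbl x y : x = y + y -> (x == 0 :> 'F_q) = (y == 0) by move=> ->; apply: (addF_eq0 q_pr q_ge11).
(* [comm] is evaluated at mu - h' and mu + h'. Of the four combinations of alternatives, two give mu
   = +-h and the other two the excluded h' = +-h. *)
have muh : (mu == h) || (mu == - h).
  have : (mu - h' + h == nu) || (mu - h' - h == - nu).
    have := comm (mu - h'); rewrite subrK eqxx muN.
    have -> : (mu - h' - h' == mu) = false.
      by apply/negbTE; rewrite -subr_eq0 (dbl _ (- h')) ?oppr_eq0 //; ring.
    by do 5 case: (_ == _).
  have : (mu + h' + h == - nu) || (mu + h' - h == nu).
    have := comm (mu + h'); rewrite addrK eqxx muN.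
    have -> : (mu + h' + h' == mu) = false.
      by apply/negbTE; rewrite -subr_eq0 (dbl _ h') //; ring.
    by do 5 case: (_ == _).
  move=> /orP[]/eqP e1 /orP[]/eqP e2.
  - rewrite -[mu == - h]subr_eq0 opprK -(dbl (mu + h' + h + (mu - h' + h))).
      by rewrite e1 e2 addNr eqxx orbT.
    by ring.
  - have : h' - - h == 0.
      rewrite -(dbl (mu + h' + h - (mu - h' - h))); last by ring.
      by rewrite e1 e2 subrr.
    by rewrite subr_eq0 (negbTE hNh).
  - have : h' - h == 0.
      rewrite -(dbl (mu + h' - h - (mu - h' + h))); last by ring.
      by rewrite e1 e2 subrr.
    by rewrite subr_eq0 (negbTE hh).
  - rewrite -[mu == h]subr_eq0 -(dbl (mu + h' - h + (mu - h' - h))).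
      by rewrite e1 e2 subrr eqxx.
    by ring.
(* With mu = +-h only the steps into and out of 0 change c, so c is a constant plus or minus
   [delta], and its value is +-1. *)
have cE : forall k, k != 0 -> c k = c (h + h).
  apply: shift_const => // m m1 m2; apply/eqP; rewrite -subr_eq0 gmu.
  by case/orP: muh => /eqP->; rewrite ?opprK (negbTE m1) (negbTE m2).
have c0 : (c (h + h) - c 0) ^+ 2 = 1.
  have := gmu h; rewrite subrr => ->.
  case/orP: muh => /eqP->; rewrite ?opprK ?eqxx [h == - h]eq_sym
    (oppF_eq q_pr q_ge11) (negbTE h0) //.
move=> t t0.
have -> : c = [ffun=> c (h + h)] + [ffun k => (c 0 - c (h + h)) * delta k].
  apply/ffunP => k; rewrite !ffunE; have [->|k0] := eqVneq k 0.
    by rewrite mulr1 addrC subrK.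
  by rewrite mulr0 addr0 cE.
rewrite evD ev_const // add0r.
have -> : ev [ffun k => (c 0 - c (h + h)) * delta k] t = (c 0 - c (h + h))%:~R * ev delta t.
  by rewrite /ev mulr_sumr; apply: eq_bigr => k _; rewrite ffunE rmorphM mulrA.
by rewrite ev_delta mulr1 -rmorphXn /= -opprB sqrrN c0.
Qed.

Local Notation alpha := (alpha q).

Lemma alpha_not_sumsq s : ~ sumsq_repr s alpha.
Proof.
move=> sa.
have := sumsq_energy 2%:R sa; 
rewrite (alpha0 q_pr q_ge11) (alpha_double q_pr q_ge11) -[2%:R]/(2%:~R).
rewrite (alphaT_int q_pr q_ge11) // /energy exchange_big /=.
(* For m in L exactly one of m - 2 and m + 2 lies in {-3..3}, so the sum of the differences is odd
   and m contributes at least 1 to the total energy. *)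
pose L : seq int := [:: 2; 3; 4; 5; -2; -3; -4; -5].
pose F (m : 'F_q) := \sum_(c <- s) (c (m + 2%:~R) - c (m - 2%:~R)) ^+ 2.
have F0 m : 0 <= F m by apply: sumr_ge0 => c _; apply: sqr_ge0.
have FL : all (fun i : int => 1 <= F i%:~R) L.
  have F1 (i : int) : (`|(i + 2)%R| < 8)%N -> (`|(i - 2)%R| < 8)%N ->
      (`|(i + 2)%R| < 4)%N != (`|(i - 2)%R| < 4)%N -> 1 <= F i%:~R.
    move=> i1 i2 i3; have [y1] := sumsq_parity sa (i + 2)%:~R.
    have [y2] := sumsq_parity sa (i - 2)%:~R.
    rewrite !(alpha_double q_pr q_ge11) !(alphaT_int q_pr q_ge11) // => y2E y1E.
    have [x xE] : exists x, \sum_(c <- s) (c (i + 2)%:~R - c (i - 2)%:~R) = 1 + 2 * x.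
      rewrite sumrB; move: y1E y2E i3.
      move: (\sum_(c <- s) c (i + 2)%:~R) (\sum_(c <- s) c (i - 2)%:~R) => X Z.
      move: (\sum_(c <- s) c 0) => Y XE ZE i3.
      exists ((X - Z - 1) %/ 2)%Z; move: XE ZE i3; do ?case: ifP; lia.
    by have := sum_sqr_odd xE; rewrite /F intrD intrB.
  by rewrite /L /all !F1.
pose L' : seq 'F_q := [seq i%:~R | i <- L].
have uL : uniq L'.
  rewrite map_inj_in_uniq // => i j iL jL /eqP; rewrite -subr_eq0 -intrB (intrF_eq0 q_pr q_ge11).
    by rewrite subr_eq0 => /eqP.
  have L5 k : k \in L -> (`|k| <= 5)%N.
    by have /allP := (isT : all (fun k : int => (`|k| <= 5)%N) L); apply.
  by have := L5 i iL; have := L5 j jL; lia.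
have : \sum_(m in L') F m <= \sum_m F m.
  by rewrite [leRHS](bigID (mem L')) /= lerDl sumr_ge0.
have : 8 <= \sum_(m in L') F m.
  rewrite -big_uniq // big_map.
  have -> : 8 = \sum_(i <- L) (1 : int) by rewrite !big_cons big_nil.
  by rewrite !big_seq; apply: ler_sum => i iL; exact: (allP FL).
by rewrite -/F => S1 S2 S3; move: (le_trans S1 S2); rewrite /F S3.
Qed.

(** As the right-hand side is even, [sumsq_parity] makes all coefficients of the sum S congruent to
    S(0) modulo 2; subtracting the constant S(0) leaves the values at t <> 0 unchanged. *)
Lemma sumsq_half s (b : {ffun 'F_q -> int}) : sumsq_repr s (b + b) -> exists2 w, evenf w &
  forall t, t != 0 -> \sum_(c <- s) ev c t = 2 * ev w t.
Proof.
move=> sb; have [/allP se _] := sb; pose S : {ffun 'F_q -> int} := \sum_(c <- s) c.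
have Se k : S (- k) = S k.
  by rewrite !sum_ffunE !big_seq; apply: eq_bigr => c /se /evenfP ->.
pose w : {ffun 'F_q -> int} := [ffun k => ((S k - S 0)%R %/ 2)%Z].
have wE k : S k = w k + w k + S 0.
  have [y] := sumsq_parity sb k; rewrite -!sum_ffunE -/S 2!ffunE => SE.
  rewrite [w k]ffunE -[LHS](subrK (S 0)) SE; congr (_ + _).
  by move: (b (k + k)) (b 0); clear; lia.
exists w => [|t t0]; first by apply/evenfP => k; rewrite !ffunE Se.
rewrite -ev_sum -/S; have -> : S = w + w + [ffun=> S 0].
  by apply/ffunP => k; rewrite [LHS]wE [RHS]ffunE [X in _ = X + _]ffunE [X in _ = _ + X]ffunE.
by rewrite !evD ev_const // addr0 mulr_natl mulr2n.
Qed.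

Lemma evenf_delta : evenf delta.
Proof. by apply/evenfP => k; rewrite !ffunE oppr_eq0. Qed.

Lemma evenfB c c' : evenf c -> evenf c' -> evenf (c - c').
Proof.
by move=> /evenfP ec /evenfP ec'; apply/evenfP => k; rewrite !ffunE ec ec'.
Qed.

Lemma energy_delta h : h != 0 -> energy h delta = 2.
Proof.
move=> h0; rewrite energy_conv ?evenf_delta //.
have cE m : conv delta m = delta m.
  rewrite ffunE (bigD1 0) //= big1 => [|k k0]; last by rewrite ffunE (negbTE k0) mul0r.
  by rewrite addr0 [X in X * _]ffunE eqxx mul1r subr0.
by rewrite !cE !ffunE eqxx (addF_eq0 q_pr q_ge11) (negbTE h0).
Qed.

(** These are the functions that represent 0. *)
Definition is_const (c : {ffun 'F_q -> int}) := [forall k, c k == c 0].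

(** These are the functions that represent +-1. *)
Definition is_sqrt1 (c : {ffun 'F_q -> int}) :=
  [forall t, (t != 0) ==> (ev c t ^+ 2 == 1)].

Lemma energy_ge2 h (c : {ffun 'F_q -> int}) : h != 0 -> evenf c -> ~~ is_const c ->
  2 <= energy h c.
Proof.
move=> h0 ec; apply: contraR => e2; apply/forallP => k; apply/eqP.
apply: (energy_eq0 h0); have [y yE] := energy_parity h ec.
by have := energy_ge0 h c; move: e2; rewrite yE; lia.
Qed.

Definition energy3 (c : {ffun 'F_q -> int}) :=
  energy 1%:~R c + energy 2%:~R c + energy 3%:~R c.

(** The three energies are even and at least 2, and by [energy2_unit] at most one of them is 2: the
    sum is at least 2 + 4 + 4. *)
Lemma energy3_ge10 (c : {ffun 'F_q -> int}) :
  evenf c -> ~~ is_const c -> ~~ is_sqrt1 c -> 10 <= energy3 c.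
Proof.
move=> ec nc nu.
have i0 (i : int) : (0 < `|i| < 11)%N -> i%:~R != 0 :> 'F_q.
  by move=> i11; rewrite (intrF_eq0 q_pr q_ge11); lia.
have ge2 (i : int) : (0 < `|i| < 11)%N -> 2 <= energy i%:~R c.
  by move=> /i0 i1; apply: energy_ge2.
have ne (i j : int) : (0 < `|i| < 5)%N -> (0 < `|j| < 5)%N -> i != j -> i != - j ->
    energy i%:~R c = 2 -> energy j%:~R c = 2 -> False.
  move=> i5 j5 ij iNj e1 e2; case/negP: nu; apply/forallP => t; apply/implyP => t0.
  apply/eqP; apply: (energy2_unit ec _ _ _ _ e2 e1) => //; try by apply: i0; lia.
    by rewrite -subr_eq0 -intrB (intrF_eq0 q_pr q_ge11) ?subr_eq0 //; lia.
  by rewrite -addr_eq0 -intrD (intrF_eq0 q_pr q_ge11) ?addr_eq0 //; lia.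
have [y1 y1E] := energy_parity 1%:~R ec; have [y2 y2E] := energy_parity 2%:~R ec.
have [y3 y3E] := energy_parity 3%:~R ec.
have := ge2 1 isT; have := ge2 2 isT; have := ge2 3 isT.
have := ne 1 2 isT isT isT isT; have := ne 1 3 isT isT isT isT.
have := ne 2 3 isT isT isT isT; rewrite /energy3 y1E y2E y3E; lia.
Qed.

Lemma twice_alpha_not_sumsq s : ~ sumsq_repr s (alpha + alpha).
Proof.
move=> sa; have [/allP se sE] := sa.
(* Roots equal to 0 are dropped and roots +-1 are replaced by 1; t counts the latter and N keeps all
   others. *)
pose N := [seq c <- s | ~~ is_const c && ~~ is_sqrt1 c].
pose t := count (fun c => ~~ is_const c && is_sqrt1 c) s.
have Na : sumsq_repr (N ++ nseq t delta) (alpha + alpha).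
  split=> [|x x0].
    rewrite all_cat all_nseq evenf_delta orbT andbT; apply/allP => c.
    by rewrite mem_filter => /andP[_ /se].
  rewrite -sE // big_cat /= big_filter {}/t; elim: (s) => [|c s' IHs].
    by rewrite /= !big_nil addr0.
  rewrite !big_cons /= -IHs; case: (boolP (is_const c)) => [/forallP cc|_] /=.
    have -> : ev c x = 0; last by rewrite expr0n add0r.
    by rewrite -(ev_const (c 0) x0); congr ev; apply/ffunP => k; rewrite ffunE; apply/eqP.
  case: (boolP (is_sqrt1 c)) => [/forallP /(_ x)|_] /=; last by rewrite addrA.
  by rewrite x0 => /eqP ->; rewrite big_cons ev_delta expr1n addrCA.
clearbody t.
have NE (i : int) : (0 < `|i| < 4)%N ->
    \sum_(c <- N) energy i%:~R c + 2 * t%:Z = 8.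
  move=> /andP[i0 i4E]; have := sumsq_energy i%:~R Na.
  rewrite big_cat /= big_nseq iter_addr_0 energy_delta ?(intrF_eq0 q_pr q_ge11); try lia.
  have aa k : (alpha + alpha) k = alpha k + alpha k by rewrite ffunE.
  rewrite !aa (alpha0 q_pr q_ge11) (alpha_double q_pr q_ge11) (alphaT_int q_pr q_ge11); try lia.
  have -> : (i == 0) = false by lia.
  rewrite i4E; move: (\sum_(c <- N) _); lia.
(* The three totals of 8 add up to 24; a member of N uses at least 10 of it and a root 1 uses 3 * 2.
   So N has at most two members. *)
have N10 : 10 * (size N)%:Z + 6 * t%:Z <= 24.
  have : \sum_(c <- N) energy3 c + 6 * t%:Z = 24.
    rewrite !big_split /=; have := NE 1 isT; have := NE 2 isT; have := NE 3 isT.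
    move: (\sum_(c <- N) energy 1%:~R c) (\sum_(c <- N) energy 2%:~R c).
    by move: (\sum_(c <- N) energy 3%:~R c); lia.
  have : \sum_(c <- N) 10 <= \sum_(c <- N) energy3 c.
    rewrite !big_seq; apply: ler_sum => c; rewrite mem_filter => /andP[/andP[c1 c2] /se c3].
    exact: energy3_ge10.
  rewrite big_const_seq count_predT iter_addr_0 -mulr_natr natz.
  by move: (\sum_(c <- N) energy3 c); lia.
have [w ew wE] := sumsq_half Na.
(* The identity ((A + B)/2)^2 + ((A - B)/2)^2 = (A^2 + B^2)/2, with W = (A + B)/2. *)
have dbl A B E W : A ^+ 2 + B ^+ 2 = E + E -> A + B = 2 * W ->
    W ^+ 2 + (W - B) ^+ 2 = E :> algC.
  move=> E1 E2; apply: (@mulfI _ 2); first by rewrite pnatr_eq0.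
  have -> : 2 * E = E + E by rewrite mulr_natl mulr2n.
  rewrite -E1.
  have -> : A = 2 * W - B by rewrite -E2 addrK.
  by ring.
have [_ NaE] := Na; have eN : all evenf N.
  by apply/allP => c; rewrite mem_filter => /andP[_ /se].
clearbody N.
case: N NE N10 Na wE NaE eN => [|c1 [|c2 [|c3 N]]] NE N10 Na wE NaE eN; last first.
- by move: N10 => /=; lia.
- have t0 : t = 0%N by move: N10 => /=; lia.
  have /and3P[e1 e2 _] := eN; apply: (@alpha_not_sumsq [:: w; w - c2]).
  split=> [|x x0]; first by rewrite /= ew evenfB.
  move: (NaE x x0) (wE x x0); rewrite t0 cats0 !big_cons !big_nil !addr0 !evD evN.
  by apply: dbl.
- have /andP[e1 _] := eN; have : (t <= 2)%N by move: N10 => /=; lia.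
  case: t NE N10 Na wE NaE => [|[|[|//]]] NE N10 Na wE NaE _.
  (* A single root: [dbl] with B = 0. *)
  + apply: (@alpha_not_sumsq [:: w; w]); split=> [|x x0]; first by rewrite /= ew.
    move: (NaE x x0) (wE x x0); rewrite !big_cons !big_nil !addr0 evD => E1 E2.
    by rewrite -[X in X ^+ 2 + _](subr0 (ev w x)) addrC; apply: (dbl (ev c1 x));
      rewrite ?addr0 ?expr0n ?addr0.
  + apply: (@alpha_not_sumsq [:: w; w - delta]).
    split=> [|x x0]; first by rewrite /= ew evenfB ?evenf_delta.
    move: (NaE x x0) (wE x x0); rewrite !big_cons !big_nil !addr0 !evD evN.
    by apply: dbl.
  (* Here c1 = 2w - 2, and (c1^2 + 2)/2 = 2 (w - 1)^2 + 1. *)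
  + apply: (@alpha_not_sumsq [:: w - delta; w - delta; delta]).
    split=> [|x x0]; first by rewrite /= !evenfB ?evenf_delta.
    move: (NaE x x0) (wE x x0); rewrite !big_cons !big_nil !addr0 !evD evN !ev_delta => E1 E2.
    apply: (@mulfI _ 2); first by rewrite pnatr_eq0.
    rewrite [RHS]mulr_natl [RHS]mulr2n -E1; have -> : ev c1 x = 2 * ev w x - 2.
      by rewrite -E2; ring.
    by ring.
(* Only roots 1 are left, and 2t = 8; then alpha would be 2 = 1 + 1. *)
- have t4 : t = 4%N by have := NE 1 isT; rewrite big_nil; lia.
  apply: (@alpha_not_sumsq [:: delta; delta]).
  split=> [|x x0]; first by rewrite /= evenf_delta.
  apply: (@mulfI _ 2); first by rewrite pnatr_eq0.
  rewrite [RHS]mulr_natl [RHS]mulr2n -evD -NaE // t4 /= !big_cons !big_nil !ev_delta.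
  by ring.
Qed.

End PrimeCase.

(** * Negacyclic convolutions *)

Section NegacyclicSums.
Local Open Scope ring_scope.

Lemma sum_split_half (V : nmodType) (F : nat -> V) n :
  \sum_(k < n + n) F k = \sum_(k < n) (F k + F (n + k)%N).
Proof. by rewrite big_split_ord big_split. Qed.

Lemma sum_split_parity (V : nmodType) (F : nat -> V) n :
  \sum_(k < n + n) F k = \sum_(k < n) F k.*2 + \sum_(k < n) F k.*2.+1.
Proof.
elim: n => [|n IHn]; first by rewrite !big_ord0 addr0.
by rewrite addSn addnS !big_ord_recr /= IHn -!addnn !addrA; congr (_ + _); rewrite addrAC.
Qed.

Lemma sum_rev (V : nmodType) (F : nat -> V) n :
  \sum_(k < n) F (n - k.+1)%N = \sum_(k < n) F k.
Proof. by rewrite [RHS](reindex_inj rev_ord_inj). Qed.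

Lemma sum_periodic (F : int -> int) (n : nat) (s : int) :
  (forall k : int, F (k + n%:Z) = F k) ->
  \sum_(k < n) F (s + k%:Z) = \sum_(k < n) F k%:Z.
Proof.
move=> Fn.
have S1 (t : int) : \sum_(k < n) F (t + 1 + k%:Z) = \sum_(k < n) F (t + k%:Z).
  case: n Fn => [|n] Fn; first by rewrite !big_ord0.
  rewrite big_ord_recr [RHS]big_ord_recl /= addrC -(Fn (t + _)); congr (F _ + _); first by lia.
  by apply: eq_bigr => k _; congr F; rewrite /bump /=; lia.
elim: s => [|s IHs|s IHs]; first by under eq_bigr do rewrite add0r.
  by rewrite -IHs -[RHS]S1; apply: eq_bigr => k _; congr F; lia.
by rewrite -IHs -S1; apply: eq_bigr => k _; congr F; lia.
Qed.

(** On Z/2d the reflection k -> 2j - k fixes only j and j - d; all other terms pair up. *)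
Lemma sum_reflect_parity (F : int -> int) (d : nat) (j : int) :
  (forall k : int, F (k + (d + d)%:Z) = F k) -> (forall k : int, F (j + j - k) = F k) ->
  exists y : int, \sum_(k < d + d) F k%:Z = F j - F (j - d%:Z) + 2 * y.
Proof.
move=> Fp Fr; rewrite -(sum_periodic (j - d%:Z) Fp).
pose g (k : nat) := F (j - d%:Z + k%:Z).
rewrite (sum_split_half g) big_split /= -(sum_rev (fun k => g (d + k)%N)).
exists (\sum_(k < d) g k).
have -> : \sum_(k < d) g (d + (d - k.+1))%N = \sum_(k < d) g k.+1.
  by apply: eq_bigr => k _; rewrite /g -Fr; congr F; have := ltn_ord k; lia.
have -> : \sum_(k < d) g k.+1 = \sum_(k < d) g k + g d - g 0%N.
  elim: (d) => [|m IHm]; first by rewrite !big_ord0 add0r subrr.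
  by rewrite !big_ord_recr /= IHm; ring.
have -> : F j = g d by rewrite /g; congr F; lia.
have -> : F (j - d%:Z) = g 0%N by rewrite /g; congr F; lia.
by ring.
Qed.

(** With the c_i extended to Z according to zeta^n = -1, [R t] is the coefficient of zeta^t in the
    sum of the x_i^2. *)
Lemma negacyclic_sumsq (m f : nat) (c : 'I_m -> int -> int) :
  let n := (f + f + (f + f) + (f + f + (f + f)))%N in
  let R t := \sum_i \sum_(k < n) c i k%:Z * c i (t - k%:Z) in
  (forall i k, c i (- k) = c i k) -> (forall i k, c i (k + n%:Z) = - c i k) ->
  R 0 = 4 -> (forall l : nat, R (2 * (2 * l%:Z + 1)) = 0) -> R 1 = 0.
Proof.
pose e := (f + f)%N; pose d := (e + e)%N; rewrite -/e -/d => n R cE cA R0 Rodd.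
pose D k := \sum_i c i k ^+ 2.
have cB i k : c i (k - n%:Z) = - c i k by rewrite -[in RHS](subrK n%:Z k) cA opprK.
have DE k : D (- k) = D k by apply: eq_bigr => i _; rewrite cE.
have DA k : D (k + n%:Z) = D k by apply: eq_bigr => i _; rewrite cA sqrrN.
have D0 k : 0 <= D k by apply: sumr_ge0 => i _; apply: sqr_ge0.
have Dn : \sum_(k < n) D k%:Z = 4.
  rewrite -R0 /R exchange_big; apply: eq_bigr => k _; apply: eq_bigr => i _.
  by rewrite sub0r cE.
(* In [R (2 * j)], the fixed points j and j - d of k -> 2j - k contribute c(j)^2 and -c(j - d)^2, up
   to even numbers; [R (2 * j)] is 0 for odd j. *)
have Dpar (l : nat) : exists y : int, D (2 * l%:Z + 1) + D (2 * l%:Z + 1 + d%:Z) = 2 * y.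
  set j := 2 * l%:Z + 1.
  have [y yE] : exists y : int, R (2 * j) = D j + D (j + d%:Z) + 2 * y.
    rewrite /R /D -big_split /=.
    apply: (big_ind2 (fun a b => exists y : int, a = b + 2 * y)).
    - by exists 0.
    - by move=> a1 b1 a2 b2 [y1 ->] [y2 ->]; exists (y1 + y2); ring.
    move=> i _; pose F k := c i k * c i (2 * j - k).
    have [||y yE] := @sum_reflect_parity F d j.
    - move=> k; rewrite /F opprD addrA cB -/n cA; ring.
    - by move=> k; rewrite /F mulrC; congr (c i _ * c i _); ring.
    exists y; rewrite -/n /F in yE *; rewrite {}yE; congr (_ + _).
    have -> : 2 * j - j = j by ring.
    have -> : 2 * j - (j - d%:Z) = j + d%:Z by ring.
    have -> : c i (j - d%:Z) = - c i (j + d%:Z).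
      by rewrite -cB; congr (c i _); rewrite /n; lia.
    by ring.
  by exists (- y); move: yE; rewrite Rodd; move: (D _) (D _); lia.
have oddE (x : nat) : (x.*2.+1)%:Z = 2 * x%:Z + 1 by lia.
pose H (l : nat) := D (l.*2.+1)%:Z.
(* Odd indices are grouped as k and k + d, with an even sum [G] by [Dpar]; the symmetry k -> n - k
   matches these groups in pairs, which gives the second factor 2. *)
have [y yE] : exists y : int, \sum_(l < d) H l = 4 * y.
  rewrite /d sum_split_half; pose G l := H l + H (e + l)%N.
  rewrite -/e; have -> : \sum_(l < e) (H l + H (e + l)%N) = \sum_(l < e) G l by [].
  rewrite {1}/e sum_split_half big_split /= -(sum_rev (fun l => G (f + l)%N)).
  have -> : \sum_(l < f) G (f + (f - l.+1))%N = \sum_(l < f) G l.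
    apply: eq_bigr => l _; rewrite /G addrC; congr (_ + _); rewrite /H.
      by rewrite -DE -DA; congr D; have := ltn_ord l; rewrite /n /d /e; lia.
    by rewrite -DE -DA; congr D; have := ltn_ord l; rewrite /n /d /e; lia.
  have [y ->] : exists y : int, \sum_(l < f) G l = 2 * y; last by exists y; ring.
  apply: (big_ind (fun a => exists y : int, a = 2 * y)) => [|a b [y1 ->] [y2 ->]|l _].
  - by exists 0.
  - by exists (y1 + y2); ring.
  have [y yE] := Dpar l; exists y; rewrite -yE /G /H oddE; congr (_ + D _).
  by rewrite /d; lia.
have Esplit := sum_split_parity (fun k => D k%:Z) d; rewrite Dn -/n in Esplit.
have E0 : 0 <= \sum_(l < d) D (l.*2)%:Z by apply: sumr_ge0 => l _; apply: D0.
have O0 : 0 <= \sum_(l < d) H l by apply: sumr_ge0 => l _; apply: D0.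
have vanish (F : nat -> nat) : \sum_(l < d) D (F l)%:Z = 0 ->
    forall i (l : nat), (l < d)%N -> c i (F l)%:Z = 0.
  move=> /eqP; rewrite psumr_eq0 => [/allP F0|l _]; last exact: D0.
  move=> i l ld.
  have := F0 (Ordinal ld) (mem_index_enum _); rewrite /= psumr_eq0 => [/allP c0|? _];
    last exact: sqr_ge0.
  by have := c0 i (mem_index_enum _); rewrite /= sqrf_eq0 => /eqP.
(* The odd part is a multiple of 4 between 0 and 4, and the even part is the complement to 4. *)
have [odd0|even0] : (\sum_(l < d) H l = 0) \/ (\sum_(l < d) D (l.*2)%:Z = 0).
- move: Esplit E0 O0 yE; rewrite -/(H _).
  by move: (\sum_(l < d) H l) (\sum_(l < d) D (l.*2)%:Z); lia.
(* In each product of [R 1] the indices k and 1 - k have opposite parities, so one factor vanishes;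
   the same holds in the other case. *)
- have c0 := vanish (fun l => l.*2.+1) odd0.
  rewrite /R big1 // => i _; apply: big1 => k _.
  have := odd_double_half k; case: (odd k) => kE.
    by rewrite -kE add1n c0 ?mul0r //; have := ltn_ord k; rewrite /n; lia.
  have -> : c i (1 - k%:Z) = 0; last by rewrite mulr0.
  case kh : (k./2) => [|h].
    by rewrite -kE kh /= subr0 (c0 i 0%N) //; have := ltn_ord k; rewrite /n; lia.
  rewrite -cE -(c0 i h); first by congr (c i _); lia.
  by move: kE (ltn_ord k); rewrite kh add0n => <-; rewrite /n -addnn; lia.
- have c0 := vanish (fun l => l.*2) even0.
  rewrite /R big1 // => i _; apply: big1 => k _.
  have := odd_double_half k; case: (odd k) => kE; last first.
    by rewrite -kE add0n c0 ?mul0r //; have := ltn_ord k; rewrite /n; lia.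
  rewrite -[c i (1 - _)]cE -[X in _ * c i X](_ : (k./2.*2)%:Z = _); last by lia.
  by rewrite c0 ?mulr0 //; have := ltn_ord k; rewrite /n; lia.
Qed.

End NegacyclicSums.

(** * Integrality of the coefficients *)

Section Integrality.
Local Open Scope ring_scope.

(* Taking the product over [ws]: m ^ (size ws) / p is an algebraic integer. *)
Lemma int_dvd_prod (p : nat) (m : int) (ws : seq algC) : prime p ->
  \prod_(w <- ws) (1 - w) = p%:R ->
  (forall w, w \in ws -> exists2 y, y \in Aint & m%:~R = (1 - w) * y) ->
  (p %| m)%Z.
Proof.
move=> p_pr wsp mw.
have [Y YA mY] : exists2 y, y \in Aint & (m ^+ size ws)%:~R = p%:R * y :> algC.
  rewrite -wsp {wsp}; elim: ws mw => [|w ws IHws] mw.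
    by exists 1; rewrite ?big_nil ?mul1r.
  have [y yA yE] := mw w (mem_head _ _).
  have [x xw|y' y'A y'E] := IHws; first by apply: mw; rewrite inE xw orbT.
  exists (y * y'); first exact: rpredM.
  by rewrite /= exprS rmorphM /= y'E yE big_cons mulrACA.
have p0 : p%:R != 0 :> algC by rewrite pnatr_eq0 -lt0n prime_gt0.
have YQ : Y \in Crat.
  have -> : Y = (m ^+ size ws)%:~R / p%:R by rewrite mY mulrC mulKf.
  by rewrite rpred_div ?rpred_int ?rpred_nat.
have /intrP[k kE] := Cint_rat_Aint YQ YA.
have {mY} : m ^+ size ws = p%:Z * k.
  by apply/(@intr_inj algC); rewrite mY rmorphM /= kE.
move=> /(congr1 absz); rewrite abszX abszM => mE; rewrite dvdzE.
have : (p %| `|m| ^ size ws)%N by rewrite mE dvdn_mulr.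
by rewrite Euclid_dvdX // => /andP[].
Qed.

(** Write x = w^i; the quotient is the geometric sum 1 + w + ... + w^(i-1). *)
Lemma prim_root_sub1_dvd n (w x : algC) : n.-primitive_root w -> x ^+ n = 1 ->
  exists2 y, y \in Aint & 1 - x = (1 - w) * y.
Proof.
move=> wn /(prim_rootP wn)[i ->]; exists (\sum_(j < i) w ^+ j).
  by apply: rpred_sum => j _; rewrite rpredX ?(Aint_prim_root wn).
by rewrite -opprB subrX1 -mulNr opprB.
Qed.

(** This is (X^q - 1)/(X - 1) evaluated at 1. *)
Lemma prim_root_prime_prod q (z : algC) : prime q -> q.-primitive_root z ->
  \prod_(w <- [seq z ^+ i | i <- iota 1 q.-1]) (1 - w) = q%:R.
Proof.
move=> q_pr zq; have q0 := prime_gt0 q_pr.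
have := factor_Xn_sub_1 zq; rewrite big_ltn // expr0 subrX1 => /mulfI.
rewrite polyXsubC_eq0 => /(_ isT) /(congr1 (horner^~ 1)).
rewrite horner_prod horner_sum big_map /index_iota subn1.
under eq_bigr do rewrite hornerXsubC.
by move=> ->; under eq_bigr do rewrite hornerXn expr1n; rewrite sumr_const card_ord.
Qed.

Variables (q : nat) (z : algC).
Hypotheses (q_pr : prime q) (z_prim : q.-primitive_root z).

Lemma chi_prim (t : 'F_q) : t != 0 -> q.-primitive_root (chi z t).
Proof.
move=> t0; rewrite /chi prim_root_exp_coprime // coprime_sym prime_coprime //.
apply/negP => /dvdn_leq; rewrite lt0n => /(_ t0).
by have := ltn_ord t; rewrite [X in (_ < X)%N]Fp_cast //; lia.
Qed.

Lemma chiN (t : 'F_q) : chi z (- t) = (chi z t)^-1.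
Proof.
apply/esym/mulr1_eq; rewrite -(chiD q_pr z_prim) subrr; exact: chi0.
Qed.

(** The exponents of P are folded modulo q into rational coefficients a(k). The function c(k) = a(k)
    - a(0) has the same values at t <> 0, and its integrality is proved through traces. *)
Lemma prime_coef_int (P : {poly rat}) :
  (forall w : algC, q.-primitive_root w -> (map_poly ratr P).[w] \in Aint) ->
  (forall w : algC, q.-primitive_root w ->
     (map_poly ratr P).[w^-1] = (map_poly ratr P).[w]) ->
  exists2 c : {ffun 'F_q -> int}, evenf c &
    forall t, t != 0 -> ev z c t = (map_poly ratr P).[chi z t].
Proof.
move=> PA Pinv; pose x (t : 'F_q) := (map_poly ratr P).[chi z t].
pose a (k : 'F_q) : rat := \sum_(m < size P | m%:R == k) P`_m.
have xE (t : 'F_q) : x t = \sum_k ratr (a k) * chi z (k * t).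
  rewrite /x horner_coef size_map_poly (partition_big (fun m : 'I__ => m%:R : 'F_q) predT) //.
  apply: eq_bigr => k _; rewrite rmorph_sum mulr_suml; apply: eq_bigr => m /eqP <-.
  rewrite coef_map /= /chi; congr (_ * _).
  rewrite -exprM -(prim_expr_mod z_prim (t * m)); congr (z ^+ _).
  rewrite [RHS]/= [X in _ = (_ %% X)%N](Fp_cast q_pr).
  by rewrite val_Fp_nat // modnMml mulnC.
have xchi (k t : 'F_q) : x t * (chi z (- (k * t)) - 1) =
    \sum_l ratr (a l) * (chi z ((l - k) * t) - chi z (l * t)).
  rewrite xE mulr_suml; apply: eq_bigr => l _.
  by rewrite -mulrA mulrBr mulr1 -(chiD q_pr z_prim) -mulrBl.
have xsum (k : 'F_q) : \sum_(t | t != 0) x t * (chi z (- (k * t)) - 1) =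
    q%:R * ratr (a k - a 0).
  have -> : \sum_(t | t != 0) x t * (chi z (- (k * t)) - 1) =
            \sum_t x t * (chi z (- (k * t)) - 1).
    by rewrite [RHS](bigD1 0) //= mulr0 oppr0 chi0 subrr mulr0 add0r.
  under eq_bigr do rewrite xchi.
  rewrite exchange_big /= (eq_bigr (fun l => q%:R *
    (ratr (a l) * (l == k)%:R - ratr (a l) * (l == 0)%:R))) => [|l _].
    rewrite -mulr_sumr; congr (_ * _); rewrite sumrB rmorphB /=.
    have pick j : \sum_l ratr (a l) * (l == j)%:R = ratr (a j) :> algC.
      by rewrite (bigD1 j) //= eqxx mulr1 big1 ?addr0 // => l /negbTE->; rewrite mulr0.
    by rewrite !pick.
  have csum (r : 'F_q) : \sum_t chi z (r * t) = q%:R * (r == 0)%:R.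
    under eq_bigr do rewrite mulrC.
    by rewrite (chi_sum q_pr z_prim); case: eqP; rewrite ?mulr1 ?mulr0.
  rewrite -mulr_sumr sumrB !csum subr_eq0; ring.
have Aq (w u : algC) : q.-primitive_root w -> u ^+ q = 1 ->
    exists2 y, y \in Aint & u - 1 = (1 - w) * y.
  move=> wq uq; have [y yA yE] := prim_root_sub1_dvd wq uq.
  by exists (- y); rewrite ?rpredN // mulrN -yE opprB.
have chiq (t : 'F_q) : chi z t ^+ q = 1.
  by rewrite /chi -exprM mulnC exprM (prim_expr_order z_prim) expr1n.
(* q (a k - a 0) is a trace of an integer times chi - 1, hence divisible by 1 - w;
   this removes the denominator q. *)
have xdvd (k : 'F_q) w : q.-primitive_root w ->
    exists2 y, y \in Aint & q%:R * ratr (a k - a 0) = (1 - w) * y.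
  move=> wq; rewrite -xsum.
  apply: (big_ind (fun u => exists2 y, y \in Aint & u = (1 - w) * y)).
  - by exists 0; rewrite ?mulr0.
  - by move=> u v [y yA ->] [y' y'A ->]; exists (y + y'); rewrite ?rpredD ?mulrDr.
  move=> t t0; have [y yA ->] := Aq w _ wq (chiq (- (k * t))).
  by exists (x t * y); rewrite 1?mulrCA // rpredM // PA // chi_prim.
have cint (k : 'F_q) : exists m : int, a k - a 0 == m%:~R.
  have [m mE] : exists m : int, q%:R * (a k - a 0) = m%:~R.
    have [y yA yE] := xdvd k z z_prim.
    have aA : q%:R * ratr (a k - a 0) \in Aint.
      by rewrite yE rpredM ?rpredB ?(Aint_prim_root z_prim).
    have aQ : q%:R * ratr (a k - a 0) \in Crat by rewrite rpredM ?rpred_nat ?Crat_rat.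
    have /intrP[m mE] := Cint_rat_Aint aQ aA.
    exists m; apply/(fmorph_inj (ratr : rat -> algC)).
    by rewrite rmorphM /= ratr_nat ratr_int.
  have /dvdzP[d dE] : (q %| m)%Z.
    apply: (int_dvd_prod q_pr (prim_root_prime_prod q_pr z_prim)) => w.
    case/mapP => i; rewrite mem_iota => iq ->.
    have /(xdvd k) [y yA yE] : q.-primitive_root (z ^+ i).
      rewrite prim_root_exp_coprime // coprime_sym prime_coprime //.
      by apply/negP => /dvdn_leq; lia.
    by exists y; rewrite // -yE -ratr_int -mE rmorphM /= ratr_nat.
  exists d; apply/eqP/(@mulfI _ q%:R); first by rewrite pnatr_eq0 -lt0n prime_gt0.
  by rewrite mE dE rmorphM /= mulrC.
pose c : {ffun 'F_q -> int} := [ffun k => xchoose (cint k)].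
have cE (k : 'F_q) : (c k)%:~R = a k - a 0 by rewrite ffunE -(eqP (xchooseP (cint k))).
have cev (t : 'F_q) : t != 0 -> ev z c t = x t.
  move=> t0; have z0 : ratr (a 0) * \sum_k chi z (k * t) = 0 :> algC.
    by rewrite (chi_sum q_pr z_prim) (negbTE t0) mulr0.
  rewrite xE -[RHS]subr0 -[X in _ = _ - X]z0 mulr_sumr -sumrB; apply: eq_bigr => k _.
  by rewrite -mulrBl -rmorphB /= -cE ratr_int.
(* Symmetry determines c(-k) - c(k) up to a constant, which is 0 by comparison at k = 0. *)
exists c => //; apply/evenfP => k.
have c_inj := @ev_inj_const _ _ q_pr z_prim [ffun k => c (- k)] c.
have := c_inj _ k 0; rewrite !ffunE oppr0 => /(_ _)/addIr -> // t t0.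
rewrite cev // /x -Pinv ?chi_prim // -chiN -/(x (- t)) -cev ?oppr_eq0 //.
rewrite /ev [RHS](reindex_inj oppr_inj) /=; apply: eq_bigr => l _.
by rewrite ffunE mulrNN.
Qed.

End Integrality.

(** * Integrality of the coefficients for q = 2n a power of two *)

Section PowerOfTwo.
Local Open Scope ring_scope.
Variables (n N : nat) (z : algC).
Hypotheses (nE : n = (2 ^ N.+1)%N) (z_prim : (n + n).-primitive_root z).

Let n_gt0 : (0 < n)%N. Proof. by rewrite nE expn_gt0. Qed.

Lemma prim_root_half : z ^+ n = -1.
Proof.
have /eqP : (z ^+ n) ^+ 2 = 1 by rewrite -exprM muln2 -addnn (prim_expr_order z_prim).
rewrite sqrf_eq1 -(prim_order_dvd z_prim) => /orP[/dvdn_leq|/eqP//].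
by move=> /(_ n_gt0); lia.
Qed.

(** For t < n these are all the conjugates of z. *)
Definition oddpow (t : nat) : algC := z ^+ t.*2.+1.

Lemma oddpow_prim t : (n + n).-primitive_root (oddpow t).
Proof.
rewrite /oddpow prim_root_exp_coprime //.
have -> : (n + n = 2 ^ N.+2)%N by rewrite nE addnn -mul2n -expnS.
by rewrite coprimeXr // coprimen2 /= odd_double.
Qed.

Lemma oddpow_n t : oddpow t ^+ n = -1.
Proof. by rewrite /oddpow -exprM mulnC exprM prim_root_half -signr_odd /= odd_double expr1. Qed.

(** A geometric sum with ratio z^(2k), which differs from 1 when n does not divide k. *)
Lemma oddpow_sum (k : int) : ~~ (n%:Z %| k)%Z -> \sum_(t < n) oddpow t ^ k = 0.
Proof.
move=> nk.
have zu : z \is a GRing.unit by rewrite unitfE (prim_root_eq0 z_prim); lia.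
have oE t : oddpow t ^ k = z ^ k * (z ^ (2 * k)) ^+ t.
  rewrite /oddpow !exprnP !exprz_exp -expfzDr //; last by rewrite -unitfE.
  by congr (_ ^ _); lia.
under eq_bigr do rewrite oE.
rewrite -mulr_sumr; apply/eqP; rewrite mulf_eq0; apply/orP; right.
have : (z ^ (2 * k) - 1) * (\sum_(t < n) (z ^ (2 * k)) ^+ t) = 0.
  rewrite -subrX1 exprnP exprz_exp -[2 * k * n%:Z](_ : (n + n)%:Z * k = _); last by lia.
  by rewrite -exprz_exp -exprnP (prim_expr_order z_prim) exp1rz subrr.
move/eqP; rewrite mulf_eq0 => /orP[|//].
rewrite subr_eq0 => z1; case/negP: nk; move: z1.
have zk (m : nat) : z ^+ (2 * m) = 1 -> (n %| m)%N.
  by move=> /eqP; rewrite -(prim_order_dvd z_prim) addnn -mul2n dvdn_pmul2l.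
case: k {oE} => m; first by rewrite -PoszM -exprnP => /eqP /zk; rewrite dvdzE.
rewrite NegzE mulrN -invr_expz invr_eq1 -PoszM -exprnP => /eqP /zk.
by rewrite dvdzE abszN.
Qed.

(** Each factor is z (z^-1 - z^(2t)), and X^n - 1, the product of the X - z^(2t), takes the value -2
    at z^-1; finally z^n = -1. *)
Lemma prod_sub_oddpow : \prod_(w <- [seq oddpow t | t <- iota 0 n]) (1 - w) = 2%:R.
Proof.
have z2 : n.-primitive_root (z ^+ 2).
  by have := exp_prim_root z_prim 2; rewrite addnn -mul2n gcdnMr mulKn.
have := factor_Xn_sub_1 z2 => /(congr1 (horner^~ z^-1)).
rewrite horner_prod hornerD hornerN hornerC hornerXn exprVn prim_root_half big_map /index_iota subn0.
under eq_bigr do rewrite hornerXsubC.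
have z0 : z != 0 by rewrite (prim_root_eq0 z_prim); lia.
move=> E; have : \prod_(i <- iota 0 n) (z * (z^-1 - (z ^+ 2) ^+ i)) = 2.
  rewrite big_split /= E big_const_seq count_predT size_iota iter_mulr_1 prim_root_half invrN invr1.
  by ring.
by move=> <-; apply: eq_bigr => i _; rewrite mulrBr divff // /oddpow -exprM exprS mul2n.
Qed.

Lemma lambda_dvd_int (m : int) (y : algC) :
  y \in Aint -> m%:~R = (1 - z) * y -> (2 %| m)%Z.
Proof.
move=> yA mE; apply: (int_dvd_prod (isT : prime 2) prod_sub_oddpow) => w /mapP[t _ ->].
have [y' y'A y'E] := prim_root_sub1_dvd (oddpow_prim t) (prim_expr_order z_prim).
by exists (y' * y); rewrite ?rpredM // mE y'E mulrA.
Qed.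

(** Each of the n factors 1 - w of 2 is a multiple of 1 - z. *)
Lemma lambda_pow_dvd2 : exists2 v, v \in Aint & 2 = (1 - z) ^+ n * v.
Proof.
have gen (s : seq algC) : {in s, forall w, w ^+ (n + n) = 1} ->
    exists2 v, v \in Aint & \prod_(w <- s) (1 - w) = (1 - z) ^+ size s * v.
  elim: s => [|w s IHs] s1; first by exists 1; rewrite ?big_nil ?mulr1.
  have [y yA yE] := prim_root_sub1_dvd z_prim (s1 w (mem_head _ _)).
  have [x xs|v vA vE] := IHs; first by apply: s1; rewrite inE xs orbT.
  by exists (y * v); rewrite ?rpredM // big_cons vE yE /= exprS mulrACA.
have [w /mapP[t _ ->]|v vA] := gen [seq oddpow t | t <- iota 0 n].
  exact: prim_expr_order (oddpow_prim t).
by rewrite prod_sub_oddpow size_map size_iota => vE; exists v.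
Qed.

Lemma even_coefs (P : {poly int}) (y : algC) : (size P <= n)%N -> y \in Aint ->
  (map_poly intr P).[z] = 2 * y -> exists P' : {poly int}, P = 2%:P * P'.
Proof.
move=> sP yA Py; pose lam := 1 - z.
have lamA : lam \in Aint by rewrite rpredB ?(Aint_prim_root z_prim).
(* Substituting 1 - X, an involution that preserves the size, expands P in powers of lam. *)
pose Q := P \Po (1 - 'X).
have QP : Q \Po (1 - 'X) = P.
  by rewrite -comp_polyA comp_polyB comp_polyC comp_polyX opprB addrC subrK comp_polyXr.
have sQ : (size Q <= n)%N.
  by rewrite size_comp_poly2 // -opprB size_polyN size_XsubC.
have Ql : (map_poly intr Q).[lam] = 2 * y.
  rewrite map_comp_poly horner_comp rmorphB /= rmorph1 map_polyX !hornerE.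
  by rewrite opprB addrC subrK.
have [v vA vE] := lambda_pow_dvd2.
have lam0 : lam != 0.
  by apply/eqP => l0; move: vE; rewrite -/lam l0 expr0n gtn_eqF // mul0r;
    apply/eqP; rewrite pnatr_eq0.
(* Q(lam) is divisible by lam^n ~ 2: the lowest odd coefficient Q`_j would be
   divisible by lam, hence even. *)
have Qeven j : (2 %| Q`_j)%Z.
  elim/ltn_ind: j => j IHj; have [jn|nj] := ltnP j n; last first.
    by rewrite nth_default ?dvdz0 // (leq_trans sQ).
  have [u uA uE] : exists2 u, u \in Aint & (Q`_j)%:~R * lam ^+ j = lam ^+ j.+1 * u.
    have two (k : int) : (2 %| k)%Z ->
        exists2 u, u \in Aint & k%:~R = lam ^+ j.+1 * u.
      case/dvdzP => k' ->; exists (k'%:~R * lam ^+ (n - j.+1) * v).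
        by rewrite !rpredM ?rpredX ?rpred_int.
      by rewrite rmorphM /= [2%:~R]vE -{1}(subnKC jn) exprD; ring.
    have : (Q`_j)%:~R * lam ^+ j = 2 * y - \sum_(i < n | i != j :> nat) (Q`_i)%:~R * lam ^+ i.
      rewrite -Ql (horner_coef_wide _ (leq_trans (size_poly _ _) sQ)).
      under eq_bigr do rewrite coef_map.
      by rewrite (bigD1 (Ordinal jn)) //= addrK.
    move=> ->; have [u uA uE] : exists2 u, u \in Aint &
        \sum_(i < n | i != j :> nat) (Q`_i)%:~R * lam ^+ i = lam ^+ j.+1 * u.
      apply: (big_ind (fun a => exists2 u, u \in Aint & a = lam ^+ j.+1 * u)).
      - by exists 0; rewrite ?mulr0.
      - by move=> a b [u uA ->] [u' u'A ->]; exists (u + u'); rewrite ?rpredD ?mulrDr.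
      move=> i; case: ltngtP => // ij _.
        have [u uA ->] := two _ (IHj i ij).
        by exists (u * lam ^+ i); rewrite ?mulrA // rpredM ?rpredX.
      exists ((Q`_i)%:~R * lam ^+ (i - j.+1)); first by rewrite rpredM ?rpredX ?rpred_int.
      by rewrite -[X in _ * lam ^+ X = _](subnKC ij) exprD mulrCA.
    have [u' u'A u'E] := two 2 (dvdzz 2).
    exists (u' * y - u); first by rewrite rpredB ?rpredM.
    by rewrite uE mulrBr mulrA -u'E.
  apply: (lambda_dvd_int uA); apply: (mulIf (expf_neq0 j lam0)).
  by rewrite uE exprSr -/lam; ring.
have [Q' QE] : exists Q' : {poly int}, Q = 2%:P * Q'.
  exists (\poly_(i < size Q) (Q`_i %/ 2)%Z); apply/polyP => i.
  rewrite coefCM coef_poly; case: ltnP => [_|sQi]; last by rewrite mulr0 nth_default.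
  by rewrite mulrC divzK.
by exists (Q' \Po (1 - 'X)); rewrite -QP QE comp_polyM comp_polyC.
Qed.

Lemma pow2_dvd_coefs M (Q : {poly int}) (y : algC) : (size Q <= n)%N -> y \in Aint ->
  (map_poly intr Q).[z] = 2 ^+ M * y -> exists Q' : {poly int}, Q = (2 ^+ M)%:P * Q'.
Proof.
elim: M Q => [|M IHM] Q sQ yA Qy; first by exists Q; rewrite expr0 mul1r.
have [||Q1 Q1E] := @even_coefs Q (2 ^+ M * y) sQ.
- by rewrite rpredM ?rpredX ?rpred_nat.
- by rewrite Qy exprS mulrA.
have [|||Q' Q'E] := IHM Q1; last first.
- by exists Q'; rewrite Q1E Q'E mulrA exprS polyCM.
- apply: (@mulfI _ 2); first by rewrite pnatr_eq0.
  by rewrite mulrA -exprS -Qy Q1E rmorphM /= map_polyC hornerM hornerC.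
- exact: yA.
by move: sQ; rewrite Q1E size_Cmul.
Qed.

(** Fourier inversion: the coefficient of zeta^m recovered from the conjugates x(t), for every
    integer m. *)
Definition negacoef (x : nat -> algC) (m : int) : algC :=
  n%:R^-1 * \sum_(t < n) x t * oddpow t ^ (- m).

Lemma negacoefDn x m : negacoef x (m + n%:Z) = - negacoef x m.
Proof.
rewrite /negacoef -mulrN -sumrN; congr (_ * _); apply: eq_bigr => t _.
have o0 : oddpow t != 0 by rewrite (prim_root_eq0 (oddpow_prim t)); lia.
rewrite opprD expfzDr // -(invr_expz _ n%:Z) -exprnP oddpow_n invrN invr1.
by rewrite mulrN1 mulrN.
Qed.

Lemma negacoef_sum (x : nat -> algC) (c : nat -> algC) (k : nat) : (k < n)%N ->
  (forall t, (t < n)%N -> x t = \sum_(l < n) c l * oddpow t ^+ l) ->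
  negacoef x k%:Z = c k.
Proof.
move=> kn xE; rewrite /negacoef.
have n0 : n%:R != 0 :> algC by rewrite pnatr_eq0 -lt0n.
apply: (mulfI n0); rewrite mulVKf //.
rewrite (eq_bigr (fun t : 'I_n => \sum_(l < n) c l * oddpow t ^ (l%:Z - k%:Z))) => [|t _].
  rewrite exchange_big /= (bigD1 (Ordinal kn)) //= [X in _ + X]big1 => [|l lk].
    rewrite addr0 (eq_bigr (fun=> c k)) => [|t _]; last by rewrite subrr expr0z mulr1.
    by rewrite sumr_const card_ord mulr_natl.
  rewrite -mulr_sumr oddpow_sum ?mulr0 //; apply/negP => /dvdzP[j jE].
  move: lk; rewrite -val_eqE /= => lk; have := ltn_ord l; have j0 : j <> 0 by lia.
  by move=> ln; nia.
rewrite xE // mulr_suml; apply: eq_bigr => l _.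
have o0 : oddpow t != 0 by rewrite (prim_root_eq0 (oddpow_prim t)); lia.
by rewrite -mulrA expfzDr.
Qed.

(** Let P' be P modulo X^n + 1. Each n P'_k is a trace of algebraic integers, hence an integer; as n
    P' takes at z a value divisible by n = 2^(N+1), [pow2_dvd_coefs] removes the denominator. *)
Lemma pow2_coef_int (P : {poly rat}) :
  (forall w : algC, (n + n).-primitive_root w -> (map_poly ratr P).[w] \in Aint) ->
  (forall w : algC, (n + n).-primitive_root w ->
     (map_poly ratr P).[w^-1] = (map_poly ratr P).[w]) ->
  exists c : int -> int,
    [/\ forall k, c (- k) = c k, forall k, c (k + n%:Z) = - c k,
        forall m, (c m)%:~R = negacoef (fun t => (map_poly ratr P).[oddpow t]) m &
        forall t, (map_poly ratr P).[oddpow t] = \sum_(k < n) (c k%:Z)%:~R * oddpow t ^+ k].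
Proof.
move=> PA Pinv; pose x t := (map_poly ratr P).[oddpow t].
pose F : {poly rat} := 'X^n + 1; pose P' := P %% F.
have sF : size F = n.+1 by rewrite size_addl ?size_polyXn // size_poly1.
have sP' : (size P' <= n)%N.
  by rewrite -ltnS -sF ltn_modp -size_poly_gt0 sF.
have sP'C : (size (map_poly (ratr : rat -> algC) P') <= n)%N by rewrite size_map_poly.
have xE t : x t = \sum_(l < n) ratr P'`_l * oddpow t ^+ l.
  rewrite /x (divp_eq P F) -/P' rmorphD rmorphM /= hornerD hornerM.
  have -> : (map_poly ratr F).[oddpow t] = 0.
    by rewrite rmorphD /= map_polyXn rmorph1 hornerD hornerXn hornerC oddpow_n addNr.
  rewrite mulr0 add0r (horner_coef_wide _ sP'C).
  by apply: eq_bigr => l _; rewrite coef_map.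
have cE (k : nat) : (k < n)%N -> negacoef x k%:Z = ratr P'`_k.
  by move=> kn; apply: (@negacoef_sum x (fun k => ratr P'`_k)).
have n0 : n%:R != 0 :> algC by rewrite pnatr_eq0 -lt0n.
have nP'int (k : nat) : exists m : int, n%:R * P'`_k == m%:~R.
  have [nk|kn] := leqP n k.
    by exists 0; rewrite nth_default ?mulr0 // (leq_trans sP').
  have nA : n%:R * ratr P'`_k \in Aint.
    rewrite -cE // /negacoef mulVKf // rpred_sum // => t _; rewrite rpredM //.
      exact/PA/oddpow_prim.
    have wA : (oddpow t)^-1 \in Aint.
      have /prim_order_gt0 := oddpow_prim t; rewrite -(@prednK (n + n)); last by lia.
      move=> _; have := prim_expr_order (oddpow_prim t).
      rewrite -(@prednK (n + n)); last by lia.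
      rewrite exprS => /mulr1_eq ->; rewrite rpredX //.
      exact: (Aint_prim_root (oddpow_prim t)).
    by rewrite -invr_expz -exprnP -exprVn rpredX.
  have nQ : n%:R * ratr P'`_k \in Crat by rewrite rpredM ?rpred_nat ?Crat_rat.
  have /intrP[m mE] := Cint_rat_Aint nQ nA.
  exists m; apply/eqP/(fmorph_inj (ratr : rat -> algC)).
  by rewrite rmorphM /= ratr_nat ratr_int.
pose Q : {poly int} := \poly_(k < n) xchoose (nP'int k).
have QE : map_poly intr Q = n%:R *: P'.
  apply/polyP => k; rewrite coef_map coef_poly coefZ.
  case: ltnP => [kn|nk]; first by rewrite /= -(eqP (xchooseP (nP'int k))).
  by rewrite nth_default ?mulr0 // (leq_trans sP').
have [||Q' Q'E] := @pow2_dvd_coefs N.+1 Q (x 0%N) (size_poly _ _).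
- exact/PA/oddpow_prim.
- have -> : map_poly intr Q = map_poly ratr (map_poly intr Q) :> {poly algC}.
    by rewrite -map_poly_comp; apply: eq_map_poly => a /=; rewrite ratr_int.
  rewrite QE map_polyZ hornerZ /= ratr_nat nE natrX; congr (_ * _).
  rewrite xE (horner_coef_wide _ sP'C).
  by rewrite /oddpow expr1; apply: eq_bigr => k _; rewrite coef_map.
have P'E (k : nat) : P'`_k = (Q'`_k)%:~R.
  apply: (@mulfI _ (n%:R : rat)); first by rewrite pnatr_eq0 -lt0n.
  have /polyP/(_ k) := QE; rewrite coefZ => <-.
  rewrite coef_map Q'E coefCM /= rmorphM /= nE natrX; congr (_ * _).
  by rewrite rmorphXn.
have cint m : negacoef x m \in Num.int.
  have n0' : n%:Z != 0 by lia.
  rewrite (divz_eq m n%:Z) addrC; move: (m %/ n)%Z => j.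
  have /gez0_abs <- : 0 <= (m %% n)%Z by rewrite modz_ge0.
  have kn : (`|(m %% n)%Z| < n)%N by have := ltz_pmod m (n_gt0 : 0 < n%:Z); lia.
  move: (`|_|)%N kn => k kn.
  elim: j => [|j IHj|j IHj].
  - by rewrite mul0r addr0 cE // P'E ratr_int.
  - by rewrite -addn1 PoszD mulrDl mul1r addrA negacoefDn rpredN.
  rewrite -rpredN -negacoefDn.
  by have -> : k%:Z + - j.+1%:Z * n%:Z + n%:Z = k%:Z + - j%:Z * n%:Z by lia.
pose c m := Num.floor (negacoef x m).
have cC m : (c m)%:~R = negacoef x m by rewrite /c floorK.
(* Reversing the order of the conjugates inverts them, so the symmetry of P gives c(-k) = c(k). *)
have orev t : (t < n)%N -> oddpow (n - t.+1) = (oddpow t)^-1.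
  move=> tn; apply/esym/mulr1_eq; rewrite /oddpow -exprD.
  by rewrite -[(_ + _)%N](_ : (n + n = _)%N) ?(prim_expr_order z_prim) //; lia.
exists c; split=> [k|k|//|t].
- apply: (@intr_inj algC); rewrite !cC /negacoef; congr (_ * _).
  rewrite (reindex_inj rev_ord_inj) /=; apply: eq_bigr => t _.
  by rewrite /x orev // Pinv ?oddpow_prim // opprK exprz_inv.
- by apply: (@intr_inj algC); rewrite cC negacoefDn rmorphN /= cC.
by rewrite -/(x t) xE; apply: eq_bigr => k _; rewrite cC cE.
Qed.

Lemma negacoef_conv (m : nat) (P : 'I_m -> {poly rat}) (c : 'I_m -> int -> int) :
  (forall i k, (c i k)%:~R = negacoef (fun t => (map_poly ratr (P i)).[oddpow t]) k) ->
  (forall i t, (map_poly ratr (P i)).[oddpow t] =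
      \sum_(k < n) (c i k%:Z)%:~R * oddpow t ^+ k) ->
  forall k : int, (\sum_i \sum_(l < n) c i l%:Z * c i (k - l%:Z))%:~R =
    negacoef (fun t => \sum_i (map_poly ratr (P i)).[oddpow t] ^+ 2) k.
Proof.
move=> cE PE k; rewrite rmorph_sum /negacoef /=.
under [in RHS]eq_bigr do rewrite mulr_suml.
rewrite exchange_big mulr_sumr; apply: eq_bigr => i _ /=.
transitivity (n%:R^-1 * \sum_(t < n) \sum_(l < n) (c i l%:Z)%:~R * oddpow t ^+ l *
    ((map_poly ratr (P i)).[oddpow t] * oddpow t ^ (- k))); last first.
  by congr (_ * _); apply: eq_bigr => t _; rewrite -mulr_suml -PE expr2 mulrA.
rewrite exchange_big mulr_sumr rmorph_sum; apply: eq_bigr => l _ /=.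
rewrite rmorphM /= cE [in LHS]cE -cE /negacoef mulrCA mulr_sumr; congr (_ * _).
apply: eq_bigr => t _.
have o0 : oddpow t != 0 by rewrite (prim_root_eq0 (oddpow_prim t)); lia.
by rewrite opprB expfzDr // -exprnP; ring.
Qed.
End PowerOfTwo.

(** * Impossibility of the representations in algC *)

Section NoRepresentation.
Local Open Scope ring_scope.

(** Such a P stands for an integer of the real subfield: its values are integral and invariant under
    complex conjugation. *)
Definition sym_int_poly q (P : {poly rat}) := forall w : algC, q.-primitive_root w ->
  (map_poly ratr P).[w] \in Aint /\ (map_poly ratr P).[w^-1] = (map_poly ratr P).[w].

Lemma not_sumsq_pow2 N (m : nat) (P : 'I_m -> {poly rat}) :
  let q := (2 ^ N.+4)%N in
  (forall i, sym_int_poly q (P i)) ->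
  ~ (forall w : algC, q.-primitive_root w ->
       \sum_i (map_poly ratr (P i)).[w] ^+ 2 = 2 * (2 + w + w^-1)).
Proof.
move=> q Psym PE; pose f := (2 ^ N)%N.
pose n := (f + f + (f + f) + (f + f + (f + f)))%N.
have nE : n = (2 ^ N.+2.+1)%N by rewrite /n /f; rewrite !expnS; lia.
have qE : q = (n + n)%N by rewrite /q nE expnS mul2n addnn.
have f0 : (0 < f)%N by rewrite expn_gt0.
have [z z_prim] : {z : algC | (n + n).-primitive_root z}.
  by apply: C_prim_root_exists; rewrite /n; lia.
rewrite qE in Psym PE.
have /fin_all_exists[c cP] : forall i, _ := fun i => pow2_coef_int nE z_prim
  (fun w wq => (Psym i w wq).1) (fun w wq => (Psym i w wq).2).
have n8 : (8 <= n)%N by rewrite /n; lia.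
have n0 : n%:R != 0 :> algC by rewrite pnatr_eq0; lia.
have RE k : (\sum_i \sum_(l < n) c i l%:Z * c i (k - l%:Z))%:~R =
    negacoef n z (fun t => 2 * (2 + oddpow z t + (oddpow z t)^-1)) k :> algC.
  rewrite (negacoef_conv nE z_prim (P := P)) => [|i l|i t]; first 1 last.
  - by case: (cP i).
  - by case: (cP i).
  by congr (_ * _); apply: eq_bigr => t _; rewrite PE //; apply: (oddpow_prim nE).
have SE k : negacoef n z (fun t => 2 * (2 + oddpow z t + (oddpow z t)^-1)) k =
    n%:R^-1 * (4 * \sum_(t < n) oddpow z t ^ (- k) + 2 * \sum_(t < n) oddpow z t ^ (1 - k)
       + 2 * \sum_(t < n) oddpow z t ^ (-1 - k)).
  rewrite /negacoef; congr (_ * _); rewrite !mulr_sumr -!big_split; apply: eq_bigr => t _ /=.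
  have o0 : oddpow z t != 0.
    by rewrite (prim_root_eq0 (oddpow_prim nE z_prim t)) -lt0n addn_gt0 (leq_trans _ n8).
  by rewrite !(expfzDr _ _ o0) // expr1z exprN1; ring.
have S0 (k : int) : `|k| < n%:Z -> k != 0 -> \sum_(t < n) oddpow z t ^ k = 0.
  move=> kn k0; apply: (oddpow_sum nE z_prim); apply/negP => /dvdzP[j jE].
  have j0 : j = 0 by move: kn; rewrite jE; clear -n8; move: n n8 => n; nia.
  by rewrite jE j0 mul0r eqxx in k0.
have S1 : \sum_(t < n) oddpow z t ^ 0 = n%:R.
  by under eq_bigr do rewrite expr0z; rewrite sumr_const card_ord.
suff /eqP : 2%:~R = 0%:~R :> algC by rewrite intr_eq0.
(* The coefficient of zeta in 2 (2 + theta_1) is 2, while [negacyclic_sumsq] makes it 0. *)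
have R1 : (\sum_i \sum_(l < n) c i l%:Z * c i (1 - l%:Z))%:~R = 2%:~R :> algC.
  rewrite RE SE subrr S1 !S0 //; last by lia.
    by rewrite !mulr0 add0r addr0 mulrCA mulVf ?mulr1.
  by lia.
rewrite -R1; congr _%:~R; apply: negacyclic_sumsq => [i k|i k||l].
- by case: (cP i).
- by case: (cP i).
- apply: (@intr_inj algC); rewrite RE SE oppr0 S1 !subr0 !S0 //; try by lia.
  by rewrite !mulr0 !addr0 mulrCA mulVf ?mulr1.
apply: (@intr_inj algC); rewrite RE SE.
(* n is a multiple of 8, so it divides no integer that is odd or 2 modulo 4. *)
have S2 (k : int) : (exists j, k = 2 * j + 1 \/ k = 4 * j + 2) ->
    \sum_(t < n) oddpow z t ^ k = 0.
  case=> j jE; apply: (oddpow_sum nE z_prim); apply/negP => /dvdzP[j' j'E].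
  move: jE; rewrite j'E /n; lia.
set k := 2 * _.
have -> : \sum_(t < n) oddpow z t ^ (- k) = 0.
  by apply: S2; exists (- l%:Z - 1); right; rewrite /k; ring.
have -> : \sum_(t < n) oddpow z t ^ (1 - k) = 0.
  by apply: S2; exists (- (2 * l%:Z + 1)); left; rewrite /k; ring.
have -> : \sum_(t < n) oddpow z t ^ (-1 - k) = 0.
  by apply: S2; exists (- (2 * l%:Z + 2)); left; rewrite /k; ring.
by rewrite !mulr0 !addr0 mulr0.
Qed.
Lemma ev_alpha q (z : algC) (t : 'F_q) : prime q -> (11 <= q)%N -> q.-primitive_root z ->
  ev z (alpha q) t = 3 + (chi z t ^+ 2 + (chi z t)^-1 ^+ 2) +
    (chi z t ^+ 4 + (chi z t)^-1 ^+ 4) + (chi z t ^+ 6 + (chi z t)^-1 ^+ 6).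
Proof.
move=> q_pr q11 zq; set w := chi z t.
have cD := chiD q_pr zq; have cN := chiN q_pr zq.
have chi_nat (k : nat) : chi z (k%:R * t) = w ^+ k.
  elim: k => [|k IHk]; first by rewrite mul0r chi0.
  by rewrite -addn1 natrD mulrDl mul1r cD IHk exprD expr1.
have dinj : injective (fun k : 'F_q => k + k).
  move=> k l kl; apply/eqP; rewrite -subr_eq0 -(addF_eq0 q_pr q11).
  have -> : k - l + (k - l) = k + k - (l + l) by ring.
  by rewrite kl subrr.
have pick (i : 'F_q) : \sum_k (k == i)%:R * chi z ((k + k) * t) = chi z (i * t) ^+ 2.
  rewrite (bigD1 i) //= eqxx mul1r big1 => [|k /negbTE->]; last by rewrite mul0r.
  by rewrite addr0 mulrDl cD expr2.
rewrite /ev (reindex_inj dinj) /=.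
transitivity (\sum_k (3 * ((k == 0)%:R * chi z ((k + k) * t)) +
   \sum_(i <- [:: 1; 2; 3; -1; -2; -3] : seq int) (k == i%:~R)%:R * chi z ((k + k) * t))).
  apply: eq_bigr => k _; rewrite (alpha_double q_pr q11) /alphaT rmorphD mulrDl.
  congr (_ + _); first by rewrite rmorphM /= !rmorph_nat mulrA.
  rewrite rmorph_sum mulr_suml; apply: eq_bigr => i _; congr (_ * _).
  by case: (_ == _).
rewrite big_split /= -mulr_sumr pick exchange_big /=.
under eq_bigr do rewrite pick.
rewrite !big_cons big_nil mul0r chi0.
have cz (k : nat) : chi z (k%:Z%:~R * t) = w ^+ k := chi_nat k.
have czN (k : nat) : chi z ((- k%:Z)%:~R * t) = w^-1 ^+ k.
  by rewrite mulrNz mulNr cN cz exprVn.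
rewrite (cz 1%N) (cz 2%N) (cz 3%N) (czN 1%N) (czN 2%N) (czN 3%N); ring.
Qed.

Lemma not_sumsq_prime q (m : nat) (P : 'I_m -> {poly rat}) : prime q -> (11 <= q)%N ->
  (forall i, sym_int_poly q (P i)) ->
  ~ (forall w : algC, q.-primitive_root w ->
       \sum_i (map_poly ratr (P i)).[w] ^+ 2 = 2 * (3 + (w ^+ 2 + w^-1 ^+ 2) +
         (w ^+ 4 + w^-1 ^+ 4) + (w ^+ 6 + w^-1 ^+ 6))).
Proof.
move=> q_pr q11 Psym PE.
have [z zq] := C_prim_root_exists (prime_gt0 q_pr).
have /fin_all_exists[c cP] : forall i, exists c : {ffun 'F_q -> int}, evenf c /\
    forall t, t != 0 -> ev z c t = (map_poly ratr (P i)).[chi z t].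
  move=> i; have [c ec cE] := prime_coef_int q_pr zq
    (fun w wq => (Psym i w wq).1) (fun w wq => (Psym i w wq).2).
  by exists c.
apply: (@twice_alpha_not_sumsq q z q_pr zq q11 [seq c i | i : 'I_m]).
split=> [|t t0].
  by apply/allP => _ /mapP[i _ ->]; have [] := cP i.
rewrite big_image /= evD ev_alpha // -[RHS]mulr2n -[RHS]mulr_natl -PE ?(chi_prim q_pr zq) //.
by apply: eq_bigr => i _; have [_ ->] := cP i.
Qed.

End NoRepresentation.

(** * Comparison of R[i] and algC *)

Lemma expr_pred_inv q (L : fieldType) (w : L) :
  (q.-primitive_root w -> w ^+ q.-1 = w^-1)%R.
Proof.
move=> wq; apply/esym/mulr1_eq; rewrite -exprS prednK ?(prim_expr_order wq) //.
exact: prim_order_gt0 wq.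
Qed.

Section Transfer.
Local Open Scope ring_scope.
Variables (q : nat).
Hypothesis q_gt0 : (0 < q)%N.
Let Phi : {poly rat} := map_poly intr 'Phi_q.

Lemma Phi_dvd_root (z : algC) (P : {poly rat}) : q.-primitive_root z ->
  root (map_poly ratr P) z = (Phi %| P).
Proof.
move=> zq; have [p [pE _] ->] := minCpolyP z; congr (_ %| _).
apply: (map_inj_poly (fmorph_inj (ratr : rat -> algC)) (rmorph0 _)).
rewrite -pE (minCpoly_cyclotomic zq) -(Cintr_Cyclotomic zq) -map_poly_comp.
by apply: eq_map_poly => a /=; rewrite ratr_int.
Qed.

(* That is, [Phi] is irreducible over Q. *)
Lemma coprime_or_Phi_dvd (P : {poly rat}) : coprimep P Phi \/ Phi %| P.
Proof.
have [z zq] := C_prim_root_exists q_gt0.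
have Phi0 : Phi != 0.
  by rewrite -size_poly_gt0 size_map_poly_id0 ?size_Cyclotomic //
    intr_eq0 lead_coef_eq0 monic_neq0 ?Cyclotomic_monic.
have /dvdpP[H HE] := dvdp_gcdr P Phi.
have : root (map_poly ratr Phi) z by rewrite Phi_dvd_root.
rewrite {1}HE rmorphM /= rootM !Phi_dvd_root // => /orP[PhiH|PhiG]; last first.
  by right; rewrite (dvdp_trans PhiG) ?dvdp_gcdl.
left; have H0 : H != 0 by apply: contraNneq Phi0 => H0; rewrite HE H0 mul0r.
have G0 : gcdp P Phi != 0 by rewrite gcdp_eq0 negb_and Phi0 orbT.
have := dvdp_leq H0 PhiH; rewrite {1}HE size_mul // /coprimep.
move: G0 H0; rewrite -!size_poly_gt0.
by move: (size (gcdp P Phi)) (size H) => a b; case: a b => [|[|a]] [|b]; lia.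
Qed.

Variable F : numFieldType.

(** As a root of X^q - 1, x is a root of some Phi_d with d dividing q; then x^d = 1, and primitivity
    forces d = q. *)
Lemma Phi_root (x : F) : q.-primitive_root x -> root (map_poly ratr Phi) x.
Proof.
move=> x_prim; have -> : map_poly ratr Phi = map_poly intr 'Phi_q :> {poly F}.
  by rewrite -map_poly_comp; apply: eq_map_poly => a /=; rewrite ratr_int.
have := prod_Cyclotomic q_gt0 => /(congr1 (map_poly (intr : int -> F))).
rewrite rmorphB /= map_polyXn rmorph1 rmorph_prod /= => /(congr1 (root^~ x)).
have -> : root ('X^q - 1) x by apply/unity_rootP; apply: prim_expr_order.
rewrite rootE horner_prod prodf_seq_eq0 => /hasP[d dq /= rd].
rewrite -dvdn_divisors // in dq.
suff -> : q = d by exact: rd.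
have d0 : (0 < d)%N by apply: dvdn_gt0 dq.
apply/eqP; rewrite eqn_dvd dq andbT (prim_order_dvd x_prim).
have := prod_Cyclotomic d0 => /(congr1 (map_poly (intr : int -> F))).
rewrite rmorphB /= map_polyXn rmorph1 rmorph_prod /= => /(congr1 (root^~ x)).
have -> : root (\prod_(i <- divisors d) map_poly intr 'Phi_i) x.
  by rewrite rootE horner_prod prodf_seq_eq0; apply/hasP; exists d; rewrite -?dvdn_divisors.
by move=> /esym/unity_rootP/eqP.
Qed.

Variable x : F.
Hypothesis x_prim : q.-primitive_root x.

(** Polynomial relations over Q pass between [R[i]] and algC: both sides amount to divisibility by
    the irreducible [Phi]. *)
Lemma root_transfer (P : {poly rat}) (z : algC) : q.-primitive_root z ->
  root (map_poly ratr P) x = root (map_poly ratr P) z.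
Proof.
move=> zq; rewrite Phi_dvd_root //; apply/idP/idP => [Px|]; last first.
  case/dvdpP=> Q ->; by rewrite rmorphM /= rootM (Phi_root x_prim) orbT.
have [/coprimepP cop|//] := coprime_or_Phi_dvd P.
have /Bezout_eq1_coprimepP[[U V] /= UV] : coprimep P Phi by apply/coprimepP.
have := congr1 (fun p => (map_poly ratr p : {poly F}).[x]) UV.
rewrite rmorphD !rmorphM /= rmorph1 hornerD !hornerM hornerC.
by rewrite (eqP Px) (eqP (Phi_root x_prim)) !mulr0 addr0 => /esym/eqP; rewrite oner_eq0.
Qed.

Lemma prim_rootV (K : fieldType) (y : K) : q.-primitive_root y -> q.-primitive_root y^-1.
Proof.
move=> yq; rewrite -(expr_pred_inv yq).
by rewrite prim_root_exp_coprime // coprimePn.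
Qed.

(** The Bezout coefficient modulo [Phi] is an inverse at all primitive roots at once. *)
Lemma inverse_at_root (P : {poly rat}) : (map_poly ratr P).[x] != 0 ->
  exists U : {poly rat}, forall y : F, q.-primitive_root y ->
    (map_poly ratr U).[y] = ((map_poly ratr P).[y])^-1.
Proof.
move=> Px; have [cop|/dvdpP[Q PE]] := coprime_or_Phi_dvd P; last first.
  by case/eqP: Px; rewrite PE rmorphM hornerM (eqP (Phi_root x_prim)) mulr0.
have [[U V] /= UV] := Bezout_eq1_coprimepP _ _ cop.
exists U => y yq; apply/esym/mulr1_eq; rewrite mulrC.
have := congr1 (fun p => (map_poly ratr p : {poly F}).[y]) UV.
by rewrite rmorphD !rmorphM /= rmorph1 hornerD !hornerM hornerC (eqP (Phi_root yq)) mulr0 addr0.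
Qed.
End Transfer.

(** * From the real subfield to symmetric rational polynomials *)

Section Generated.
Local Open Scope ring_scope.
Variables (q : nat) (F : numFieldType) (x : F).
Hypotheses (q_gt0 : (0 < q)%N) (x_prim : q.-primitive_root x).

Let xV_prim : q.-primitive_root x^-1 := prim_rootV q_gt0 x_prim.

(** The elements of Q(x) fixed by x -> x^-1; as a subfield containing x + x^-1, this set contains
    the generated field. *)
Definition sym_value : {pred F} := fun y => `[< exists P : {poly rat},
  (map_poly ratr P).[x] = y /\ (map_poly ratr P).[x^-1] = y >].

Lemma sym_value_divring : divring_closed sym_value.
Proof.
split.
- by apply/asboolP; exists 1; rewrite rmorph1 !hornerC.
- move=> _ y /asboolP[P [<- P2]] /asboolP[Q [Q1 Q2]]; apply/asboolP; exists (P - Q).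
  by rewrite rmorphB !hornerD !hornerN /= Q1 Q2 P2.
move=> _ y /asboolP[P [<- P2]] /asboolP[Q [Q1 Q2]]; apply/asboolP.
have [y0|y0] := eqVneq y 0; first by exists 0; rewrite y0 invr0 mulr0 rmorph0 !horner0.
have [|U UE] := @inverse_at_root _ q_gt0 F x x_prim Q; first by rewrite Q1.
by exists (P * U); rewrite !rmorphM !hornerM /= !UE // Q1 Q2 P2.
Qed.

Lemma in_generated_sym_value y : y \in in_generated (x + x^-1) -> y \in sym_value.
Proof.
pose SC := GRing.isDivringClosed.Build F sym_value sym_value_divring.
pose S : divringClosed F := HB.pack sym_value SC.
move=> /asboolP/(_ S); apply; apply/asboolP; exists ('X + 'X^(q.-1)).
rewrite rmorphD /= map_polyX map_polyXn !hornerD !hornerX !hornerXn !expr_pred_inv //.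
by rewrite invrK addrC.
Qed.

End Generated.

Section GeneratedIntegers.
Local Open Scope ring_scope.
Variables (q : nat) (F : numFieldType) (x : F).
Hypotheses (q_gt0 : (0 < q)%N) (x_prim : q.-primitive_root x).
Local Notation K := (generated (x + x^-1)).

Lemma val_int (a : int) : val (a%:~R : K) = a%:~R.
Proof. exact: (rmorph_int (\val : {rmorphism K -> F})). Qed.

(** A monic integral equation f(P(x)) = 0 and the relation P(x) = P(x^(q-1)) are both rational
    relations at x, so [root_transfer] carries them to every w. *)
Lemma integral_sym_int_poly (b : K) : integralOver (intr : int -> K) b ->
  exists2 P : {poly rat}, sym_int_poly q P & (map_poly ratr P).[x] = val b.
Proof.
case=> f f_monic fb.
have /(in_generated_sym_value q_gt0 x_prim)/asboolP[P [Px PxV]] := valP b.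
have tr z Q := @root_transfer q q_gt0 F x x_prim Q z.
exists P => // w wq; split.
  pose g : {poly rat} := map_poly intr f \Po P.
  have gE (L : numFieldType) (y : L) :
      (map_poly ratr g).[y] = (map_poly intr f).[(map_poly ratr P).[y]].
    rewrite /g map_comp_poly horner_comp -map_poly_comp; congr (_.[_]).
    by apply: eq_map_poly => a /=; rewrite ratr_int.
  have gx : root (map_poly ratr g) x.
    rewrite rootE gE Px; have := congr1 val (eqP fb).
    rewrite -horner_map -map_poly_comp rmorph0 => E; rewrite -E.
    apply/eqP; congr (_.[_]); apply: eq_map_poly => a /=.
    by rewrite -val_int.
  have := gx; rewrite (tr w) // rootE gE => fw.
  apply: (@root_monic_Aint (map_poly intr f)).
  - by rewrite rootE fw.
  - exact: monic_map.
  by apply/polyOverP => i; rewrite coef_map /= rpred_int.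
pose h : {poly rat} := P - (P \Po 'X^(q.-1)).
have hE (L : numFieldType) (y : L) : q.-primitive_root y ->
    (map_poly ratr h).[y] = (map_poly ratr P).[y] - (map_poly ratr P).[y^-1].
  move=> yq; rewrite /h rmorphB /= map_comp_poly hornerD hornerN horner_comp map_polyXn hornerXn.
  by rewrite expr_pred_inv.
have : root (map_poly ratr h) x by rewrite rootE hE // Px PxV subrr.
by rewrite (tr w) // rootE hE // subr_eq0 => /eqP ->.
Qed.

Lemma sumsq_sym_int_poly (a : K) (A : {poly rat}) (m : nat) (b : 'I_m -> K) :
  (forall i, integralOver (intr : int -> K) (b i)) -> a = \sum_i b i ^+ 2 ->
  val a = (map_poly ratr A).[x] ->
  exists2 P : 'I_m -> {poly rat}, forall i, sym_int_poly q (P i) &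
    forall w : algC, q.-primitive_root w ->
      \sum_i (map_poly ratr (P i)).[w] ^+ 2 = (map_poly ratr A).[w].
Proof.
move=> bint ab aA.
have /fin_all_exists[P PP] : forall i, exists P : {poly rat},
    sym_int_poly q P /\ (map_poly ratr P).[x] = val (b i).
  by move=> i; have [P P1 P2] := integral_sym_int_poly (bint i); exists P.
exists P => [i|w wq]; first by case: (PP i).
pose h : {poly rat} := \sum_i P i ^+ 2 - A.
have hE (L : numFieldType) (y : L) : (map_poly ratr h).[y] =
    \sum_i (map_poly ratr (P i)).[y] ^+ 2 - (map_poly ratr A).[y].
  rewrite /h rmorphB /= hornerD hornerN rmorph_sum horner_sum; congr (_ - _).
  by apply: eq_bigr => i _; rewrite rmorphXn horner_exp.
have : root (map_poly ratr h) x.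
  rewrite rootE hE -aA ab rmorph_sum subr_eq0; apply/eqP/eq_bigr => i _.
  by case: (PP i) => _ ->; rewrite rmorphXn.
by rewrite (root_transfer q_gt0 x_prim _ wq) rootE hE subr_eq0 => /eqP.
Qed.

Lemma gen_in : x + x^-1 \in in_generated (x + x^-1).
Proof. by apply/asboolP => S. Qed.

Definition theta : K := Generated gen_in.

Lemma integral_theta : integralOver (intr : int -> K) theta.
Proof.
have xint (y : F) : q.-primitive_root y -> integralOver (intr : int -> F) y.
  move=> yq; exists ('X^q - 1); first by rewrite monicXnsubC.
  rewrite rmorphB /= map_polyXn rmorph1; apply/unity_rootP.
  exact: prim_expr_order.
have [f f_monic fx] : integralOver (intr : int -> F) (x + x^-1).
  by apply: integral_add; apply: xint => //; apply: prim_rootV.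
exists f => //; apply/eqP/val_inj; rewrite -horner_map -map_poly_comp rmorph0.
rewrite -[RHS](eqP fx) /=; congr (_.[_]); apply: eq_map_poly => a /=.
by rewrite -val_int.
Qed.
End GeneratedIntegers.

(** * The totally positive elements *)

Section Zeta.
Local Open Scope ring_scope.
Local Open Scope complex_scope.
Variables (R : realType) (q : nat).
Hypothesis q_gt0 : (0 < q)%N.

Lemma zetaX k : zeta R q ^+ k =
  cos (k%:R * (2 * pi / q%:R)) +i* sin (k%:R * (2 * pi / q%:R)).
Proof.
elim: k => [|k IHk]; first by rewrite mul0r cos0 sin0.
rewrite exprSr IHk /zeta; set a := 2 * pi / q%:R.
rewrite -[k.+1]addn1 natrD mulrDl mul1r cosD sinD.
by apply/eqP; rewrite eq_complex /= eqxx addrC eqxx.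
Qed.

Lemma zeta_prim : q.-primitive_root (zeta R q).
Proof.
have q0 : q%:R != 0 :> R by rewrite pnatr_eq0 -lt0n.
apply/andP; split=> //; apply/forallP => i; apply/eqP; apply/idP/idP => [|/eqP i_q].
  move=> /unity_rootP; rewrite zetaX => /eqP; rewrite eq_complex /= => /andP[/eqP c1 _].
  rewrite eqn_leq ltn_ord /= leqNgt; apply/negP => iq; move: c1.
  (* Here 0 < b < pi, and cos (2b) = 1 - 2 sin^2 b is less than 1. *)
  pose b : R := i.+1%:R * (pi / q%:R).
  have -> : i.+1%:R * (2 * pi / q%:R) = b *+ 2 by rewrite /b -mulr_natr; ring.
  have b_gt0 : 0 < sin b.
    rewrite sin_gt0_pi // /b mulr_gt0 ?divr_gt0 ?pi_gt0 ?ltr0n //=.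
    rewrite mulrCA gtr_pMr ?pi_gt0 // ltr_pdivrMr ?ltr0n // mul1r ltr_nat //.
  by rewrite cos_mulr2n cos2sin2 => c1; have : 0 < sin b ^+ 2 := exprn_gt0 2 b_gt0; lra.
apply/unity_rootP; rewrite i_q zetaX mulrC divfK // mulr_natl cos2pi sin2pi.
by apply/eqP; rewrite eq_complex /= !eqxx.
Qed.
End Zeta.

Section Witnesses.
Local Open Scope ring_scope.
Variables (R : realType) (q : nat).
Hypothesis q_gt0 : (0 < q)%N.
Local Notation zeta := (zeta R q).
Local Notation K := (Kq R q).
Local Notation th := (theta zeta : K).

Let z_prim : q.-primitive_root zeta := zeta_prim R q_gt0.

Lemma Oq_int (m : int) : Oq (m%:~R : K).
Proof. exact: integral_id. Qed.

Lemma OqD (a b : K) : Oq a -> Oq b -> Oq (a + b).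
Proof. exact: integral_add. Qed.

Lemma OqM (a b : K) : Oq a -> Oq b -> Oq (a * b).
Proof. exact: integral_mul. Qed.

Lemma Oq_theta : Oq th.
Proof. exact: integral_theta q_gt0 z_prim. Qed.

Definition alpha_prime : K :=
  1 + th * th * ((th * th + (-2)%:~R) * (th * th + (-3)%:~R)).

Lemma alpha_prime_pos : Oq_pos alpha_prime.
Proof.
split=> [|s].
  have tt : Oq (th * th) by apply: OqM; apply: Oq_theta.
  apply: OqD; first exact: (Oq_int 1).
  by apply: OqM => //; apply: OqM; apply: OqD => //; apply: Oq_int.
rewrite /alpha_prime rmorphD !rmorphM !rmorphD !rmorphM !rmorph_int rmorph1.
rewrite !mulrNz; set y := s th; have : 0 <= y * y by rewrite -expr2 sqr_ge0.
(* For u < 4, u (u - 2)(u - 3) = u (u - 5/2)^2 - u/4 > -1; for u >= 4 no factor is negative. *)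
move: (y * y) => u u0; have [u4|u4] := ltP u 4.
  have : 0 <= u * (u - 5 / 2) ^+ 2 by rewrite mulr_ge0 ?sqr_ge0.
  by rewrite expr2; lra.
have : 0 <= u * ((u - 2) * (u - 3)) by rewrite !mulr_ge0 //; lra.
by lra.
Qed.

Definition alpha_pow2 : K := 2%:~R + th.

Lemma iter_sqr_sub2 (A : pzRingType) (B : pzRingType) (s : {rmorphism A -> B}) k x :
  s (iter k (fun y => y ^+ 2 - 2) x) = iter k (fun y => y ^+ 2 - 2) (s x).
Proof.
by elim: k => //= k IHk; rewrite rmorphB rmorphXn rmorph_nat IHk.
Qed.

(** If |w^2 - 2| < 2 then |w| < 2, so the bound goes back from the last iterate 0 to y. *)
Lemma iter_sqr_sub2_bound k (y : R) :
  iter k (fun y => y ^+ 2 - 2) y = 0 -> -2 < y < 2.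
Proof.
suff gen (u : R) : -2 < u < 2 -> iter k (fun y => y ^+ 2 - 2) y = u -> -2 < y < 2.
  by apply: gen; lra.
elim: k u => [|k IHk] u u2 /=; first by move=> ->.
move=> E; apply: (IHk (iter k (fun y => y ^+ 2 - 2) y)) => //.
by move: E; move: (iter _ _ _) => w E; apply/andP; split; nra.
Qed.

(* y^2 - 2 maps theta_j to theta_2j. *)
Lemma iter_sqr_sub2_add_inv (L : fieldType) k (x : L) : x != 0 ->
  iter k (fun y => y ^+ 2 - 2) (x + x^-1) = x ^+ (2 ^ k) + (x ^+ (2 ^ k))^-1.
Proof.
move=> x0; elim: k => [//|k IHk] /=; rewrite IHk expnSr exprM.
have : x ^+ (2 ^ k) != 0 by rewrite expf_neq0.
by move: (x ^+ _) => y y0; field.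
Qed.

(** N iterations send theta_1 to i + i^-1 = 0, where i = zeta^(2^N) has order 4. This holds at every
    real place, so every conjugate of theta_1 is above -2. *)
Lemma alpha_pow2_pos N : q = (2 ^ N.+2)%N -> Oq_pos alpha_pow2.
Proof.
move=> qE; split=> [|s]; first by apply: OqD; [apply: Oq_int | apply: Oq_theta].
rewrite rmorphD rmorph_int.
suff : -2 < s th < 2 by lra.
apply: (@iter_sqr_sub2_bound N); rewrite -iter_sqr_sub2 -[RHS](rmorph0 s); congr (s _).
apply: val_inj; rewrite (iter_sqr_sub2 (\val : {rmorphism K -> R[i]})) rmorph0 /=.
have z0 : zeta != 0 by rewrite (prim_root_eq0 z_prim) -lt0n.
rewrite iter_sqr_sub2_add_inv //.
have : ((zeta ^+ (2 ^ N)) ^+ 2) ^+ 2 = 1.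
  by rewrite -!exprM mulnA -!expnSr -qE (prim_expr_order z_prim).
move=> /eqP; rewrite sqrf_eq1 => /orP[|/eqP zN].
  rewrite -exprM -expnSr -(prim_order_dvd z_prim) qE dvdn_Pexp2l //; lia.
have : zeta ^+ (2 ^ N) != 0 by rewrite expf_neq0.
by move: (zeta ^+ _) zN => y yN y0; apply: (mulIf y0);
  rewrite mulrDl mulVf // -expr2 yN mul0r addNr.
Qed.
End Witnesses.

(** * The two witnesses are not sums of squares, and the conclusion *)

Section NotSums.
Local Open Scope ring_scope.
Variables (R : realType) (q : nat).
Local Notation z := (zeta R q).

Lemma twice_sumsq_sym_int_poly (a : Kq R q) (A : {poly rat}) : (0 < q)%N ->
  val a = (map_poly ratr A).[z] -> sum_of_squares_Oq (2 * a) ->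
  exists m (P : 'I_m -> {poly rat}), (forall i, sym_int_poly q (P i)) /\
    forall w : algC, q.-primitive_root w ->
      \sum_i (map_poly ratr (P i)).[w] ^+ 2 = 2 * (map_poly ratr A).[w].
Proof.
move=> q_gt0 aA [m [b [bO ab]]]; have zq := zeta_prim R q_gt0.
have vA : val (2 * a) = (map_poly ratr (2%:P * A)).[z].
  by rewrite !rmorphM /= map_polyC hornerM hornerC /= aA !rmorph_nat.
have [P P1 P2] := sumsq_sym_int_poly q_gt0 zq bO ab vA.
exists m, P; split=> // w wq; rewrite P2 // rmorphM /= map_polyC hornerM hornerC /=.
by rewrite rmorph_nat.
Qed.

Lemma twice_alpha_prime_not_sumsq : prime q -> (11 <= q)%N ->
  ~ sum_of_squares_Oq (2 * alpha_prime R q).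
Proof.
move=> q_pr q11; have q_gt0 := prime_gt0 q_pr.
pose A : {poly rat} := 3 + ('X ^+ 2 + ('X ^+ q.-1) ^+ 2) +
  ('X ^+ 4 + ('X ^+ q.-1) ^+ 4) + ('X ^+ 6 + ('X ^+ q.-1) ^+ 6).
have AE (L : numFieldType) (w : L) : q.-primitive_root w -> (map_poly ratr A).[w] =
    3 + (w ^+ 2 + w^-1 ^+ 2) + (w ^+ 4 + w^-1 ^+ 4) + (w ^+ 6 + w^-1 ^+ 6).
  move=> wq; rewrite /A !(rmorphD, rmorphXn, rmorph1) /= map_polyX.
  by rewrite !(hornerD, horner_exp, hornerX, hornerC) expr_pred_inv.
have zq := zeta_prim R q_gt0.
move=> /(@twice_sumsq_sym_int_poly _ A q_gt0)[|m [P [P1 P2]]]; last first.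
  by apply: (not_sumsq_prime q_pr q11 P1) => w wq; rewrite P2 // AE.
have z0 : z != 0 by rewrite (prim_root_eq0 zq) -lt0n.
rewrite AE // /alpha_prime !(rmorphD, rmorphM, rmorph_int) rmorph1 /= !mulrNz.
by field.
Qed.

Lemma twice_alpha_pow2_not_sumsq N : q = (2 ^ N.+4)%N ->
  ~ sum_of_squares_Oq (2 * alpha_pow2 R q).
Proof.
move=> qE; have q_gt0 : (0 < q)%N by rewrite qE expn_gt0.
pose A : {poly rat} := 2 + 'X + 'X ^+ q.-1.
have AE (L : numFieldType) (w : L) : q.-primitive_root w ->
    (map_poly ratr A).[w] = 2 + w + w^-1.
  move=> wq; rewrite /A !(rmorphD, rmorphXn, rmorph1) /= map_polyX.
  by rewrite !(hornerD, horner_exp, hornerX, hornerC) expr_pred_inv.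
have zq := zeta_prim R q_gt0.
move=> /(@twice_sumsq_sym_int_poly _ A q_gt0)[|m [P [P1 P2]]].
  by rewrite AE // /alpha_pow2 rmorphD rmorph_int /= addrA.
move: P1 P2; rewrite qE => P1 P2; apply: (not_sumsq_pow2 P1) => w wq.
by rewrite P2 // AE // qE.
Qed.
End NotSums.

Theorem theorem1p3 (R : realType) (q : nat)
    (q_ge5 : (5 <= q)%N)
    (q_prime_or_pow2 : (prime q /\ odd q) \/ (exists k : nat, q = (2 ^ k)%N))
    (twice_sum_of_squares :
       forall a : Kq R q, twice_Oq_pos a -> sum_of_squares_Oq a) :
  q = 5%N \/ q = 7%N \/ q = 8%N.
Proof.
have q_gt0 : (0 < q)%N by apply: leq_trans q_ge5.
case: q_prime_or_pow2 => [[q_pr q_odd]|[k qE]].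
  have [q11|q10] := leqP 11 q; last first.
    have : q \in [seq x <- iota 5 6 | prime x] by rewrite mem_filter q_pr mem_iota q_ge5.
    by rewrite !inE => /orP[]/eqP; [left | right; left].
  case: (twice_alpha_prime_not_sumsq q_pr q11 (R := R)); apply: twice_sum_of_squares.
  by exists (alpha_prime R q) => //; apply: alpha_prime_pos.
(* The exponents 0, 1, 2 contradict 5 <= q, and 3 gives q = 8. *)
case: k qE => [|[|[|[|N]]]] qE; [by rewrite qE in q_ge5 .. | by right; right |].
case: (twice_alpha_pow2_not_sumsq qE (R := R)); apply: twice_sum_of_squares.
by exists (alpha_pow2 R q) => //; exact: (alpha_pow2_pos R q_gt0 (N := N.+2) qE).
Qed.
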